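(* Suppose $G$ satisfies Assumption 3.1 (stated in the context). Then the limit experiment (in Le Cam's weak topology) of the sequence of experiments $(\mathcal{E}_n(G))_{n\in\mathbb{N}}$ is $$\mathcal{E}(G)=\bigl(\mathbb{Z}_+,2^{\mathbb{Z}_+},(\mathbb{Q}_h\mid h\ge 0)\bigr),\qquad \mathbb{Q}_h=\mathrm{Poisson}\bigl(hg(0)\mu_G/2\bigr).$$ More precisely, for $h\ge 0$ and $h_0>0$ we have, under $\mathbb{P}^{(n)}_{1-h_0/n^2}$, as $n\to\infty$, $$\frac{\mathrm{d}\mathbb{P}^{(n)}_{1-h/n^2}}{\mathrm{d}\mathbb{P}^{(n)}_{1-h_0/n^2}}(X_0,\ldots,X_n)\xrightarrow{d}\frac{\mathrm{d}\mathbb{Q}_h}{\mathrm{d}\mathbb{Q}_{h_0}}(Z)=\exp\Bigl(-\frac{(h-h_0)g(0)\mu_G}{2}\Bigr)\Bigl(\frac{h}{h_0}\Bigr)^{Z},$$ where $Z\sim\mathbb{Q}_{h_0}$ (and $0^0=1$), while for $h\ge 0$ and $h_0=0$ we have, under $\mathbb{P}^{(n)}_{1}$, $$\frac{\mathrm{d}\mathbb{P}^{(n)}_{1-h/n^2}}{\mathrm{d}\mathbb{P}^{(n)}_{1}}(X_0,\ldots,X_n)\xrightarrow{d}\frac{\mathrm{d}\mathbb{Q}_h}{\mathrm{d}\mathbb{Q}_{0}}(Z)=\exp\Bigl(-\frac{hg(0)\mu_G}{2}\Bigr)\mathbf{1}\{Z=0\},$$ where $Z\sim\mathbb{Q}_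0$.
   Context: Notation: $\mathbb{N}=\{1,2,\ldots\}$, $\mathbb{Z}_+=\mathbb{N}\cup\{0\}$. $G$ is a probability distribution on $\mathbb{Z}_+$ with probability mass function $g$, mean $\mu_G$ and variance $\sigma_G^2$. For $\theta\in[0,1]$, under $\mathbb{P}_\theta=\mathbb{P}_{\theta,G}$ the INAR(1) process $(X_t)_{t\ge0}$ is defined by $X_0=0$ and $X_t=\vartheta\circ X_{t-1}+\varepsilon_t$ for $t\in\mathbb{N}$, where $\vartheta\circ X_{t-1}=\sum_{j=1}^{X_{t-1}}Z^{(t)}_j$ (an empty sum is $0$), $(Z^{(t)}_j)_{j,t\in\mathbb{N}}$ are i.i.d. Bernoulli variables with success probability $\theta$, and, independently of these, $(\varepsilon_t)_{t\in\mathbb{N}}$ are i.i.d. with distribution $G$. $\mathbb{P}^{(n)}_\theta$ denotes the law of $(X_0,\ldots,X_n)$ under $\mathbb{P}_\theta$ on $\mathbb{Z}_+^{n+1}$ with its power set. $\mathcal{E}_n(G)=\bigl(\mathbb{Z}_+^{n+1},2^{\mathbb{Z}_+^{n+1}},(\mathbb{P}^{(n)}_{1-h/n^2}\mid h\ge0)\bigr)$, where for fixed $h$ the law $\mathbb{P}^{(n)}_{1-h/n^2}$ is considered for $n$ large enough that $1-h/n^2\in[0,1]$. Likelihood ratios $\mathrm{d}\mathbb{P}/\mathrm{d}\mathbb{P}'$ are the ratios of probability mass functions, i.e. densities of the part of $\mathbb{P}$ absolutely continuous with respect to $\mathbb{P}'$ (evaluated under $\mathbb{P}'$); the same convention is used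 for $\mathbb{Q}_h$. $\mathrm{Poisson}(0)$ is the point mass at $0$. Convergence of experiments: $(\mathcal{E}_n(G))_n$ converges to $\mathcal{E}(G)$ (has limit experiment $\mathcal{E}(G)$) in Le Cam's weak topology if for every finite $I\subset[0,\infty)$ and every $h_0\ge0$, under $\mathbb{P}^{(n)}_{1-h_0/n^2}$, the random vector $\bigl(\frac{\mathrm{d}\mathbb{P}^{(n)}_{1-h/n^2}}{\mathrm{d}\mathbb{P}^{(n)}_{1-h_0/n^2}}(X_0,\ldots,X_n)\bigr)_{h\in I}$ converges in distribution to $\bigl(\frac{\mathrm{d}\mathbb{Q}_h}{\mathrm{d}\mathbb{Q}_{h_0}}(Z)\bigr)_{h\in I}$ with $Z\sim\mathbb{Q}_{h_0}$. Assumption 3.1 on $G$: one of the following holds: (1) the support of $G$ is $\{0,\ldots,M\}$ for some $M\in\mathbb{N}$; (2) the support of $G$ is $\mathbb{Z}_+$, $\sigma_G^2<\infty$, and $g$ is eventually decreasing, i.e. there is $M\in\mathbb{N}$ with $g(k+1)\le g(k)$ for all $k\ge M$. *)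

(* Defs.v *)
From HB Require Import structures.
From mathcomp Require Import all_boot all_order all_algebra.
From mathcomp Require Import all_classical all_reals all_analysis.

Set Implicit Arguments.
Unset Strict Implicit.
Unset Printing Implicit Defensive.

Import Order.TTheory GRing.Theory Num.Theory.
Import numFieldNormedType.Exports.

Local Open Scope classical_set_scope.
Local Open Scope ring_scope.

Definition mutual_independence d d' (T : measurableType d)
    (V : measurableType d') (R : realType) (P : probability T R)
    (I : choiceType) (X : I -> T -> V) : Prop :=
  forall (s : seq I) (A : I -> set V), uniq s ->
    (forall i, measurable (A i)) ->
    P (\bigcap_(i in [set` s]) X i @^-1` A i) =
      (\prod_(i <- s) P (X i @^-1` A i))%E.

Definition sigma_family d' (T : Type) (V : measurableType d') (I : Type)
    (X : I -> T -> V) : set (set T) :=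
  <<s [set E | exists i B, measurable B /\ E = X i @^-1` B] >>.

Definition independent_families d d1 d2 (T : measurableType d)
    (V : measurableType d1) (W : measurableType d2) (R : realType)
    (P : probability T R) (I J : Type) (X : I -> T -> V) (Y : J -> T -> W)
    : Prop :=
  forall A B, sigma_family X A -> sigma_family Y B ->
    P (A `&` B) = (P A * P B)%E.

(* Time and thinning indices are shifted to start at 0: Z t j stands for
   Z^{(t+1)}_{j+1} and eps t for epsilon_{t+1}. *)
Fixpoint inar1 (T : Type) (Z : nat -> nat -> T -> bool) (eps : nat -> T -> nat)
    (t : nat) (w : T) : nat :=
  if t is s.+1 then (\sum_(j < inar1 Z eps s w) Z s j w + eps s w)%N else 0%N.

Record inar1_noise d (T : measurableType d) (R : realType)
    (P : probability T R) (theta : R) (G : probability nat R)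
    (Z : nat -> nat -> {mfun T >-> bool}) (eps : nat -> {mfun T >-> nat})
    : Prop := {
  thinning_law : forall t j, distribution P (Z t j) =1 bernoulli_prob theta ;
  thinning_indep :
    mutual_independence P (fun tj : nat * nat => Z tj.1 tj.2 : T -> bool) ;
  innovation_law : forall t, distribution P (eps t) =1 G ;
  innovation_indep : mutual_independence P (fun t => eps t : T -> nat) ;
  thinning_innovation_indep :
    independent_families P (fun tj : nat * nat => Z tj.1 tj.2 : T -> bool)
      (fun t => eps t : T -> nat)
}.

(* The product sigma-algebra that n.-tuple nat carries is the power set. *)
Lemma measurable_nat_tuple n (A : set (n.-tuple nat)) : measurable A.
Proof.
have mx (x : n.-tuple nat) : measurable [set x].
  have -> : [set x] = \bigcap_(i in [set: 'I_n])
      ((fun y : n.-tuple nat => tnth y i) @^-1` [set tnth x i]).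
    apply/seteqP; split=> [y -> //|y /= xy].
    by apply: eq_from_tnth => i; exact: xy.
  apply: fin_bigcap_measurable => // i _.
  by rewrite -[X in measurable X]setTI; exact: measurable_tnth.
have -> : A = \bigcup_(x in [set: n.-tuple nat])
    (if x \in A then [set x] else set0).
  apply/seteqP; split=> [x Ax|x [y _]].
    by exists x => //; rewrite mem_set.
  by case: ifPn => // /set_mem Ay ->.
by apply: countable_bigcupT_measurable => // x; case: ifP.
Qed.

Section inar1_path.
Context d (T : measurableType d).
Variables (Z : nat -> nat -> {mfun T >-> bool}) (eps : nat -> {mfun T >-> nat}).

Local Notation X := (inar1 (fun s j => Z s j) (fun s => eps s)).

Lemma measurable_inar1 t : measurable_fun setT (X t).
Proof.
elim: t => [|t IH]; first exact: measurable_cst.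
move=> _ B _; rewrite setTI.
pose S m := fun w => (\sum_(j < m) Z t j w + eps t w)%N.
have mS m : measurable_fun setT (S m).
  apply: measurable_realfun.measurable_fun_addn; last exact: measurable_funPT.
  elim: m => [|m IHm].
    by under eq_fun do rewrite big_ord0; exact: measurable_cst.
  under eq_fun do rewrite big_ord_recr /=.
  apply: measurable_realfun.measurable_fun_addn => //.
  by apply: (@measurableT_comp _ _ _ _ _ _ nat_of_bool).
have -> : X t.+1 @^-1` B = \bigcup_m (X t @^-1` [set m] `&` S m @^-1` B).
  apply/seteqP; split=> [w Bw|w [m _ [/= <- //]]].
  by exists (X t w).
apply: bigcupT_measurable => m; apply: measurableI.
  by rewrite -[X in measurable X]setTI; exact: IH.
by rewrite -[X in measurable X]setTI; exact: mS.
Qed.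

Definition inar1_path n (w : T) : n.+1.-tuple nat :=
  [tuple X i w | i < n.+1].

Lemma measurable_inar1_path n : measurable_fun setT (inar1_path n).
Proof.
apply/measurable_fun_tnthP => i.
rewrite (_ : _ \o _ = X i); first exact: measurable_inar1.
by apply/funext => w /=; rewrite tnth_mktuple.
Qed.

HB.instance Definition _ n :=
  isMeasurableFun.Build _ _ _ _ (inar1_path n) (@measurable_inar1_path n).

Definition inar1_law (R : realType) (P : R -> probability T R) (n : nat)
  (theta : R) : probability (n.+1.-tuple nat) R :=
  distribution (P theta) (inar1_path n).

End inar1_path.

Definition mass d (T : measurableType d) (R : realType) (mu : probability T R)
  (x : T) : R := fine (mu [set x]).

(* Intended for measures on a countable type with the discrete sigma-algebra;
   since a / 0 = 0, this is then a density of the part of mu that is absolutely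
   continuous with respect to nu. *)
Definition likelihood_ratio d (T : measurableType d) (R : realType)
  (mu nu : probability T R) (x : T) : R := mass mu x / mass nu x.

Definition cvg_in_distribution (R : realType) (V : topologicalType)
    (d : nat -> measure_display) (T : forall n, measurableType (d n))
    (P : forall n, probability (T n) R) (Y : forall n, T n -> V)
    d' (T' : measurableType d') (Q : probability T' R) (Y' : T' -> V) : Prop :=
  forall f : V -> R, continuous f -> (exists M, forall v, `|f v| <= M) ->
    ('E_(P n)[f \o Y n])%E @[n --> \oo] --> ('E_Q[f \o Y'])%E.

Record experiment (R : realType) (H : Type) := Experiment {
  exp_display : measure_display ;
  exp_space : measurableType exp_display ;
  exp_law : H -> probability exp_space R
}.

Definition lecam_cvg (R : realType) (H : eqType) (E : nat -> experiment R H)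
    (F : experiment R H) : Prop :=
  forall (k : nat) (I : k.-tuple H) (h0 : H), uniq I ->
    @cvg_in_distribution R 'rV[R]_k _ _ (fun n => exp_law (E n) h0)
      (fun n x => \row_(i < k)
         likelihood_ratio (exp_law (E n) (tnth I i)) (exp_law (E n) h0) x)
      _ _ (exp_law F h0)
      (fun z => \row_(i < k)
         likelihood_ratio (exp_law F (tnth I i)) (exp_law F h0) z).

Definition pmean (R : realType) (G : probability nat R) : R :=
  fine ('E_G[fun k : nat => k%:R : R])%E.

Definition psupport (R : realType) (G : probability nat R) : set nat :=
  [set k | 0 < mass G k].

Definition assumption_G (R : realType) (G : probability nat R) : Prop :=
  (exists M : nat, (0 < M)%N /\ psupport G = [set k | (k <= M)%N]) \/
  [/\ psupport G = setT,
      ('V_G[fun k : nat => k%:R : R] < +oo)%E &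
      exists M : nat, (0 < M)%N /\
        forall k, (M <= k)%N -> mass G k.+1 <= mass G k].

(* The second argument of poisson_prob is a dummy; poisson_prob 0 is the point
   mass at 0. *)
Definition poisson_limit (R : realType) (G : probability nat R) (h : R)
  : probability nat R := poisson_prob (h * mass G 0%N * pmean G / 2) 0%N.

Definition near_unit (R : realType) (n : nat) (h : R) : R := 1 - h / n%:R ^+ 2.

Definition inar1_experiment d (T : measurableType d) (R : realType)
    (Z : nat -> nat -> {mfun T >-> bool}) (eps : nat -> {mfun T >-> nat})
    (P : R -> probability T R) (n : nat) : experiment R {nonneg R} :=
  Experiment (fun h : {nonneg R} => inar1_law Z eps P n (near_unit n h%:num)).

Definition poisson_experiment (R : realType) (G : probability nat R)
  : experiment R {nonneg R} :=
  Experiment (fun h : {nonneg R} => poisson_limit G h%:num).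

(* Main.v *)
Require Import Defs.
From HB Require Import structures.
From mathcomp Require Import all_boot all_order all_algebra.
From mathcomp Require Import all_classical all_reals all_analysis.
From mathcomp Require Import measurable_realfun.
From mathcomp Require Import ring lra zify.

(** Write [g] and [mu] for the mass function and the mean of [G], and
[c = mu g(0) / 2]. The chain is Markov, so a likelihood ratio is a product over
time of ratios of transition probabilities at the death probabilities
[h / n ^ 2] and [h0 / n ^ 2].

Over [n] steps the chain follows the random walk of the innovations, is of
order [n], loses a bounded number of particles in mean, and sees two deaths at the
same time with probability [O(1 / n)] only. A transition [x -> x + k] with
[k >= 0] then contributes a factor
[exp ((h - h0) x / n ^ 2 (g(k + 1) / g(k) - 1))] up to negligible errors, since an increment
[k] comes from the innovation [k] or from the innovation [k + 1] and one death. A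
descent, one death without innovation, contributes [h / h0]. With [D] the
number of descents and [W] the sum of the terms
[X_t / n ^ 2 (g(k_t + 1) / g(k_t) - 1)], the likelihood ratio is therefore close to
[(h / h0) ^ D exp ((h - h0) W)]. The scores [g(k + 1) / g(k) - 1] have mean
[- g(0)] under [G], whence [W -> - c] by a law of large numbers. This is
[likelihood_near] for a single path and [good_path_prob] for the chain. The
assumption on [G] supplies a second moment and a bound on the scores, and both
conditions serve in the moment bounds for the exceptional events.

It remains to see that [D] is asymptotically Poisson of parameter [h0 c] under [h0].
The likelihood ratio itself gives this: for [h = s h0] with [0 < s < 1] it
integrates to nearly one, because the approximation is also valid with high
probability under [h]; so [s ^ D] has expectation close to
[exp (h0 c (s - 1))], the Poisson generating function ([change_of_measure],
[pgf_inversion], [descents_cvg]). Likelihood ratios are thus asymptotically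
functions of one integer variable whose masses converge, and
[cvg_in_distribution_levels] turns this into convergence in distribution of finite
vectors of likelihood ratios, to the same functions of a Poisson variable. These are the
Poisson likelihood ratios ([poisson_likelihood_ratio]). *)

Import Order.TTheory GRing.Theory Num.Theory.
Import numFieldNormedType.Exports.

Local Open Scope classical_set_scope.
Local Open Scope ring_scope.

(** * Multiplicative approximation by exponentials *)

(** The relation is additive in the exponents under products and quotients, so
errors made at single transitions add up along a path. *)
Definition near_exp {R : realType} (y a e : R) : Prop :=
  expR (a - e) <= y <= expR (a + e).

Lemma near_exp_le (R : realType) (y a e a' e' : R) :
  `|a - a'| + e <= e' -> near_exp y a e -> near_exp y a' e'.
Proof.
move=> h /andP[h1 h2].
have /andP[b1 b2] : - (e' - e) <= a - a' <= e' - e.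
  by rewrite -ler_norml; lra.
by rewrite /near_exp (le_trans _ h1) ?(le_trans h2) ?ler_expR; lra.
Qed.

Lemma near_expM (R : realType) (y a e y' a' e' : R) :
  near_exp y a e -> near_exp y' a' e' ->
  near_exp (y * y') (a + a') (e + e').
Proof.
move=> /andP[h1 h2] /andP[h3 h4]; apply/andP; split.
  rewrite (_ : a + a' - (e + e') = (a - e) + (a' - e')); last by ring.
  by rewrite expRD ler_pM ?expR_ge0.
rewrite (_ : a + a' + (e + e') = (a + e) + (a' + e')); last by ring.
rewrite expRD ler_pM //; first exact: le_trans (expR_ge0 _) h1.
exact: le_trans (expR_ge0 _) h3.
Qed.

Lemma near_exp_gt0 (R : realType) (y a e : R) : near_exp y a e -> 0 < y.
Proof. by move=> /andP[+ _]; apply: lt_le_trans; exact: expR_gt0. Qed.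

Lemma near_expV (R : realType) (y a e : R) :
  near_exp y a e -> near_exp y^-1 (- a) e.
Proof.
move=> h; have y0 := near_exp_gt0 _ _ _ _ h; case/andP: h => h1 h2.
apply/andP; split.
  rewrite (_ : - a - e = - (a + e)); last by ring.
  by rewrite expRN lef_pV2 ?posrE ?expR_gt0.
rewrite (_ : - a + e = - (a - e)); last by ring.
by rewrite expRN lef_pV2 ?posrE ?expR_gt0.
Qed.

Lemma near_exp_prod (R : realType) (n : nat) (y a e : nat -> R) :
  (forall t, (t < n)%N -> near_exp (y t) (a t) (e t)) ->
  near_exp (\prod_(t < n) y t) (\sum_(t < n) a t) (\sum_(t < n) e t).
Proof.
elim: n => [_|n IH h].
  by rewrite !big_ord0 /near_exp subrr addr0 expR0 lexx.
rewrite !big_ord_recr /=; apply: near_expM; last exact: h.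
by apply: IH => t tn; apply: h; rewrite ltnS ltnW.
Qed.

(** The lower bound is [1 + z = 1 / (1 - z / (1 + z)) >= exp (z / (1 + z))], and
[z / (1 + z) >= z - 2 z ^ 2] as soon as [z >= - 1 / 2]. *)
Lemma near_exp_1D (R : realType) (z : R) : `|z| <= 1 / 2 ->
  near_exp (1 + z) z (2 * z ^+ 2).
Proof.
rewrite ler_norml => /andP[z1 z2].
have z0 : 0 < 1 + z by lra.
apply/andP; split; last first.
  rewrite (le_trans (expR_ge1Dx _)) // ler_expR.
  by rewrite lerDl mulr_ge0 // sqr_ge0.
have e1 : (1 + z)^-1 <= expR (- z / (1 + z)).
  apply: le_trans (expR_ge1Dx _).
  by rewrite (_ : 1 + - z / (1 + z) = (1 + z)^-1) //; field; rewrite gt_eqF.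
have e2 : expR (z / (1 + z)) <= 1 + z.
  rewrite -[X in _ <= X]invrK -(invrK (expR _)) lef_pV2 ?posrE ?invr_gt0 ?expR_gt0 //.
  by rewrite -expRN -mulNr.
apply: le_trans e2; rewrite ler_expR.
rewrite -subr_ge0.
have -> : z / (1 + z) - (z - 2 * z ^+ 2) = z ^+ 2 * (1 + 2 * z) / (1 + z).
  by field; rewrite gt_eqF.
by rewrite divr_ge0 ?(mulr_ge0 (sqr_ge0 z)) //; lra.
Qed.

(** * The transition kernel *)

(** The probability of a transition from [x] to [y], for death probability [q] and
innovation mass function [g]. Revealing the fate of one particle at a time gives
this recursion on [x]; it replaces the binomial convolution, and every bound
below is an induction along it. *)
Fixpoint inar1_kernel {R : realType} (q : R) (g : nat -> R) (x y : nat) : R :=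
  if x is x'.+1 then
    q * inar1_kernel q g x' y +
    (1 - q) * (if y is y'.+1 then inar1_kernel q g x' y' else 0)
  else g y.

Section kernel.
Context (R : realType) (g : nat -> R) (C q : R).
Hypotheses (g0 : forall k, 0 <= g k) (gC : forall k, g k.+1 <= C * g k).
Hypotheses (C0 : 0 <= C) (q0 : 0 <= q) (q1 : q <= 1).
Local Notation K := (inar1_kernel q g).
Local Notation B := (fun x => (1 + q * C) ^+ x).

Lemma kernel_ge0 x y : 0 <= K x y.
Proof.
elim: x y => [|x IH] y //=; apply: addr_ge0; rewrite mulr_ge0 ?subr_ge0 //.
by case: y.
Qed.

(** The identity that drives the estimates of upward transitions: the kernel at a
fixed increment [k] satisfies a linear recursion in the number of particles with
small coefficient [q]. *)
Lemma kernel_upS x k :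
  K x.+1 (x.+1 + k)%N = K x (x + k)%N + q * (K x (x + k.+1)%N - K x (x + k)%N).
Proof. by rewrite /= addnS addSn; ring. Qed.

Lemma kernel_downS x :
  K x.+2 x.+1 = q * K x.+1 x.+1 + (1 - q) * K x.+1 x.
Proof. by []. Qed.

Let B1 x : 1 <= B x.
Proof. by rewrite exprn_ege1 // lerDl mulr_ge0. Qed.

Let BS x : B x <= B x.+1.
Proof. by rewrite ler_weXn2l // lerDl mulr_ge0. Qed.

Lemma kernel_up_le x k : K x (x + k)%N <= B x * g k.
Proof.
elim: x k => [|x IH] k; first by rewrite expr0 mul1r.
rewrite kernel_upS exprS.
have h1 := IH k; have h2 := IH k.+1.
have : B x * g k.+1 <= B x * (C * g k) by rewrite ler_wpM2l // (le_trans ler01).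
move=> h3.
have h4 : q * K x (x + k.+1)%N <= q * (B x * (C * g k)).
  by rewrite ler_wpM2l // (le_trans h2).
have h5 : (1 - q) * K x (x + k)%N <= (1 - q) * (B x * g k).
  by rewrite ler_wpM2l // subr_ge0.
have : 0 <= q * (B x * g k) by rewrite !mulr_ge0 // (le_trans ler01).
simpl in *; nra.
Qed.

(** Each step of the recursion [kernel_upS] moves the kernel by at most
[q (C + 1)] times its size; these moves are summed from [x = 0]. *)
Lemma kernel_up_dist1 x k :
  `|K x (x + k)%N - g k| <= x%:R * q * (C + 1) * B x * g k.
Proof.
elim: x k => [|x IH] k; first by rewrite add0n subrr normr0 !mul0r.
have st : `|q * (K x (x + k.+1)%N - K x (x + k)%N)| <= q * (C + 1) * B x * g k.
  rewrite normrM (ger0_norm q0) -!mulrA ler_wpM2l //.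
  have h1 := kernel_up_le x k; have h2 := kernel_up_le x k.+1.
  have h3 : B x * g k.+1 <= B x * (C * g k) by rewrite ler_wpM2l // (le_trans ler01).
  have := kernel_ge0 x (x + k); have := kernel_ge0 x (x + k.+1).
  simpl in *; rewrite ler_norml => ? ?; apply/andP; split; nra.
rewrite kernel_upS addrAC (le_trans (ler_normD _ _)) //.
apply: le_trans (lerD (IH k) st) _.
rewrite [leLHS](_ : _ = x.+1%:R * q * (C + 1) * B x * g k); last first.
  by rewrite -natr1; ring.
rewrite ler_wpM2r // ler_wpM2l ?BS // !mulr_ge0 ?ler0n ?addr_ge0 //.
Qed.

(** Second-order term: substituting [kernel_up_dist1] in the sum of the increments
of [kernel_upS] leaves a remainder quadratic in [x q]. *)
Lemma kernel_up_dist2 x k :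
  `|K x (x + k)%N - g k - x%:R * q * (g k.+1 - g k)| <=
  (x%:R * q * (C + 1)) ^+ 2 * B x * g k.
Proof.
elim: x k => [|x IH] k.
  by rewrite add0n subrr !mul0r subrr normr0 expr0n /= !mul0r.
rewrite kernel_upS.
set u := K x (x + k)%N in IH *; set v := K x (x + k.+1)%N.
rewrite [X in `|X|](_ : _ = (u - g k - x%:R * q * (g k.+1 - g k)) +
  q * ((v - g k.+1) - (u - g k))); last by rewrite -natr1; ring.
apply: le_trans (ler_normD _ _) _.
have Bx0 : 0 <= B x by rewrite (le_trans ler01).
have st : `|q * ((v - g k.+1) - (u - g k))| <=
    x%:R * (q * (C + 1)) ^+ 2 * B x * g k.
  rewrite normrM (ger0_norm q0).
  have h : `|(v - g k.+1) - (u - g k)| <= x%:R * q * (C + 1) ^+ 2 * B x * g k.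
    apply: le_trans (ler_normB _ _) _.
    apply: le_trans (lerD (kernel_up_dist1 x k.+1) (kernel_up_dist1 x k)) _.
    rewrite -mulrDr.
    rewrite (_ : x%:R * q * (C + 1) ^+ 2 * B x * g k =
       (x%:R * q * (C + 1) * B x) * ((C + 1) * g k)); last by ring.
    rewrite ler_wpM2l ?(mulr_ge0, addr_ge0, ler0n) //.
    by have := gC k; lra.
  rewrite (_ : x%:R * (q * (C + 1)) ^+ 2 * B x * g k =
    q * (x%:R * q * (C + 1) ^+ 2 * B x * g k)); last by ring.
  by rewrite ler_wpM2l.
apply: le_trans (lerD (IH k) st) _.
rewrite [leLHS](_ : _ = (x%:R ^+ 2 + x%:R) * (q * (C + 1)) ^+ 2 * B x * g k);
  last by ring.
rewrite (_ : (x.+1%:R * q * (C + 1)) ^+ 2 = x.+1%:R ^+ 2 * (q * (C + 1)) ^+ 2);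
  last by ring.
have hh : x%:R ^+ 2 + x%:R <= (x.+1%:R : R) ^+ 2.
  by rewrite -natr1; have := ler0n R x; nra.
rewrite ler_wpM2r // ler_pM ?ler_wpM2r ?BS ?sqr_ge0 //.
by rewrite mulr_ge0 ?sqr_ge0 ?addr_ge0 ?sqr_ge0.
Qed.

Lemma kernel_down_le x : K x.+1 x <= x.+1%:R * q * B x * g 0%N.
Proof.
elim: x => [|x IH].
  by rewrite /= mulr0 addr0 expr0 mulr1 mul1r.
rewrite kernel_downS.
have h1 : K x.+1 x.+1 <= B x.+1 * g 0%N by rewrite -{2}(addn0 x.+1) kernel_up_le.
have h2 : K x.+1 x <= x.+1%:R * q * B x.+1 * g 0%N.
  by apply: le_trans IH _; rewrite ler_wpM2r // ler_wpM2l ?BS // mulr_ge0.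
have h3 := kernel_ge0 x.+1 x.
have h4 := ler_wpM2l q0 h1; have h5 := mulr_ge0 q0 h3.
rewrite -(@natr1 _ x.+1).
move: (K _ _) (K _ _) (_ ^+ x.+1) (x.+1%:R) h2 h4 h5 {IH h1 h3}.
by move=> k1 k2 b y ? ? ?; lra.
Qed.

(** A descent by one needs a death at a time without innovation; to first order in
[q] any of the [x + 1] particles can be the one that dies. *)
Lemma kernel_down_dist x : `|K x.+1 x - x.+1%:R * q * g 0%N| <=
  (x.+1%:R * q) ^+ 2 * (C + 2) * B x * g 0%N.
Proof.
elim: x => [|x IH].
  rewrite /= mulr0 addr0 mul1r subrr normr0 !mulr_ge0 ?addr_ge0 // ler01.
rewrite kernel_downS.
rewrite [X in `|X|](_ : _ = (K x.+1 x - x.+1%:R * q * g 0%N) +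
   (q * (K x.+1 x.+1 - g 0%N) - q * K x.+1 x)); last by rewrite -(@natr1 _ x.+1); ring.
apply: le_trans (ler_normD _ _) _.
have Bx0 y : 0 <= B y by rewrite (le_trans ler01).
have h1 : `|q * (K x.+1 x.+1 - g 0%N)| <=
    q * (x.+1%:R * q * (C + 1) * B x.+1 * g 0%N).
  rewrite normrM (ger0_norm q0) ler_wpM2l //.
  by have := kernel_up_dist1 x.+1 0; rewrite addn0.
have h2 : `|q * K x.+1 x| <= q * (x.+1%:R * q * B x.+1 * g 0%N).
  rewrite ger0_norm ?mulr_ge0 ?kernel_ge0 // ler_wpM2l //.
  apply: le_trans (kernel_down_le x) _.
  by rewrite ler_wpM2r // ler_wpM2l ?BS // mulr_ge0.
have h3 : `|K x.+1 x - x.+1%:R * q * g 0%N| <=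
   (x.+1%:R * q) ^+ 2 * (C + 2) * B x.+1 * g 0%N.
  apply: le_trans IH _; rewrite ler_wpM2r // ler_wpM2l ?BS //.
  by rewrite mulr_ge0 ?sqr_ge0 ?addr_ge0.
apply: le_trans (lerD h3 (le_trans (ler_normB _ _) (lerD h1 h2))) _.
rewrite [leLHS](_ : _ = (x.+1%:R ^+ 2 + x.+1%:R) * (q ^+ 2 * (C + 2) * B x.+1 * g 0%N));
  last by ring.
rewrite [leRHS](_ : _ =
  x.+2%:R ^+ 2 * (q ^+ 2 * (C + 2) * B x.+1 * g 0%N)); last by ring.
rewrite ler_wpM2r ?(mulr_ge0, sqr_ge0, addr_ge0) //.
by rewrite -(@natr1 _ x.+1); have := ler0n R x.+1; nra.
Qed.

End kernel.

(** * One transition of the chain near the unit root *)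

(** The factor of a transition that dominates as [n] grows, up to a power of the
local parameter: one death in a descent, none otherwise. *)
Definition step_base {R : realType} (g : nat -> R) (n x y : nat) : R :=
  if (y < x)%N then x%:R / n%:R ^+ 2 * g 0%N else g (y - x)%N.

(** The derivative in the local parameter of the log-likelihood of a transition
that is not a descent; [g k.+1 / g k - 1] is the score of the increment [k] when
one death is mixed in. *)
Definition step_drift {R : realType} (g : nat -> R) (n x y : nat) : R :=
  if (y < x)%N then 0
  else x%:R / n%:R ^+ 2 * (g (y - x).+1 / g (y - x)%N - 1).

Lemma kernel_step_up (R : realType) (g : nat -> R) (C q E : R) (x k : nat) :
  (forall j, 0 <= g j) -> (forall j, g j.+1 <= C * g j) -> 0 <= C ->
  0 <= q <= 1 -> (C + 2) ^+ 2 * (1 + q * C) ^+ x <= E ->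
  2 * (x%:R * q) * E <= 1 / 2 ->
  exists2 w, inar1_kernel q g x (x + k)%N = g k * w &
    near_exp w (x%:R * q * (g k.+1 / g k - 1)) (9 * E ^+ 2 * (x%:R * q) ^+ 2).
Proof.
move=> g0 gC C0 /andP[q0 q1] hE hs.
have u0 := kernel_ge0 R g q g0 q0 q1 x (x + k).
have uB := kernel_up_le R g C q g0 gC C0 q0 q1 x k.
have a0 : 0 <= x%:R * q by rewrite mulr_ge0.
have [gk|gk] := eqVneq (g k) 0.
  (* Both sides of the equation vanish, so the target itself can serve as [w]. *)
  exists (expR (x%:R * q * (g k.+1 / g k - 1))).
    by apply/eqP; rewrite gk mul0r eq_le u0 andbT (le_trans uB) // gk mulr0.
  by rewrite /near_exp !ler_expR gerBl lerDl andbb !(sqr_ge0, mulr_ge0).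
have gk0 : 0 < g k by rewrite lt0r gk g0.
have B1 : 1 <= (1 + q * C) ^+ x by rewrite exprn_ege1 // lerDl mulr_ge0.
have := kernel_up_dist2 R g C q g0 gC C0 q0 q1 x k.
set u := inar1_kernel _ _ _ _; set a := x%:R * q in hs a0 *.
set r := g k.+1 / g k; set b := (1 + q * C) ^+ x in hE B1 *.
have gr : g k.+1 = g k * r by rewrite /r mulrC divfK.
have r0 : 0 <= r by rewrite divr_ge0.
have rC : r <= C by rewrite ler_pdivrMr.
have -> : u - g k - a * (g k.+1 - g k) = g k * (u / g k - 1 - a * (r - 1)).
  by rewrite gr; field; rewrite gk.
rewrite normrM (gtr0_norm gk0) [leRHS]mulrC ler_pM2l // => hz.
exists (1 + (u / g k - 1)); first by field; rewrite gk.
set z := u / g k - 1 in hz *.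
have E1 : (C + 2) ^+ 2 <= E by apply: le_trans hE; rewrite ler_peMr ?sqr_ge0.
have E4 : 4 <= E by apply: le_trans E1; nra.
have CE : C + 1 <= E by apply: le_trans E1; nra.
have hz' : `|z - a * (r - 1)| <= a ^+ 2 * E.
  apply: le_trans hz _; rewrite exprMn -mulrA ler_wpM2l ?sqr_ge0 //.
  apply: le_trans hE; rewrite ler_wpM2r ?(le_trans ler01) //.
  by rewrite ler_pXn2r ?nnegrE ?addr_ge0 //; lra.
have hr : `|a * (r - 1)| <= a * E.
  rewrite normrM ger0_norm // ler_wpM2l // ler_norml; apply/andP; split; lra.
have a1 : a <= 1 by nra.
have zE : `|z| <= 2 * a * E.
  have := ler_normD (z - a * (r - 1)) (a * (r - 1)); rewrite subrK; nra.
(* Since [|z| <= 2 a E], the two errors add up to [a ^ 2 E + 8 (a E) ^ 2]. *)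
apply: near_exp_le (near_exp_1D _ z (le_trans zE hs)).
have z2 : z ^+ 2 <= (2 * a * E) ^+ 2.
  rewrite -[leLHS]real_normK ?num_real // ler_pXn2r ?nnegrE //.
  exact: le_trans zE.
have a2 := sqr_ge0 a.
nra.
Qed.

Lemma kernel_step_down (R : realType) (g : nat -> R) (C q E : R) (x : nat) :
  (forall j, 0 <= g j) -> (forall j, g j.+1 <= C * g j) -> 0 <= C ->
  0 <= q <= 1 -> (C + 2) ^+ 2 * (1 + q * C) ^+ x.+1 <= E ->
  2 * (x.+1%:R * q) * E <= 1 / 2 ->
  exists2 w, inar1_kernel q g x.+1 x = x.+1%:R * q * g 0%N * w &
    near_exp w 0 (9 * E ^+ 2 * (x.+1%:R * q)).
Proof.
move=> g0 gC C0 /andP[q0 q1] hE hs.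
have u0 := kernel_ge0 R g q g0 q0 q1 x.+1 x.
have a0 : 0 <= x.+1%:R * q by rewrite mulr_ge0.
have := kernel_down_le R g C q g0 gC C0 q0 q1 x.
have := kernel_down_dist R g C q g0 gC C0 q0 q1 x.
have B1 : 1 <= (1 + q * C) ^+ x by rewrite exprn_ege1 // lerDl mulr_ge0.
have BS : (1 + q * C) ^+ x <= (1 + q * C) ^+ x.+1.
  by rewrite ler_weXn2l // lerDl mulr_ge0.
set u := inar1_kernel _ _ _ _; set a := x.+1%:R * q in hs a0 *.
set b := (1 + q * C) ^+ x in BS B1 *.
set m := a * g 0%N => hz hu.
have [m0|m0] := eqVneq m 0.
  exists 1; last by rewrite /near_exp -expR0 !ler_expR gerBl lerDl andbb !(sqr_ge0, mulr_ge0).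
  rewrite m0 mul0r; apply/eqP; rewrite eq_le u0 andbT (le_trans hu) //.
  by rewrite mulrAC -/m m0 mul0r.
have gm0 : 0 < m by rewrite lt0r m0 mulr_ge0.
exists (1 + (u / m - 1)); first by field; rewrite m0.
have E1 : (C + 2) ^+ 2 <= E.
  by apply: le_trans hE; rewrite ler_peMr ?sqr_ge0 // (le_trans B1).
have E4 : 4 <= E by apply: le_trans E1; nra.
have CE : (C + 2) * b <= E.
  apply: le_trans hE; rewrite ler_pM ?addr_ge0 //; first by rewrite (le_trans ler01).
  nra.
have zE : `|u / m - 1| <= a * E.
  have -> : u / m - 1 = (u - m) / m by field; rewrite m0.
  rewrite normrM normfV (gtr0_norm gm0) ler_pdivrMr // (le_trans hz) //.
  rewrite [leLHS](_ : _ = a * m * ((C + 2) * b)); last by rewrite /m; ring.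
  rewrite [leRHS](_ : _ = a * m * E); last by ring.
  by rewrite ler_wpM2l // mulr_ge0 // ltW.
set z := u / m - 1 in zE *.
have zh : `|z| <= 1 / 2 by lra.
apply: near_exp_le (near_exp_1D _ z zh); rewrite subr0.
have z2 : z ^+ 2 <= `|z| * (1/2).
  by rewrite -real_normK ?num_real // expr2 ler_wpM2l.
nra.
Qed.

(** Both kinds of transition in one formula. The error is [O(1 / n)] at a descent
and [O(1 / n ^ 2)] elsewhere; descents are so rare that the total error along a
path of length [n] still vanishes. *)
Lemma kernel_step (R : realType) (g : nat -> R) (C h : R) (kappa : nat) :
  (forall j, 0 <= g j) -> (forall j, g j.+1 <= C * g j) -> 0 <= C -> 0 <= h ->
  exists2 E, 0 <= E & \forall n \near \oo, forall x y,
    (x <= kappa * n)%N -> (x <= y.+1)%N ->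
    exists2 w, inar1_kernel (h / n%:R ^+ 2) g x y =
                 h ^+ (y < x)%N * step_base g n x y * w &
      near_exp w (h * step_drift g n x y)
        (E * if (y < x)%N then n%:R^-1 else (n%:R ^+ 2)^-1).
Proof.
move=> g0 gC C0 h0.
pose al := h * kappa%:R; have al0 : 0 <= al by rewrite mulr_ge0.
pose E := (C + 2) ^+ 2 * expR (C * al).
have E0 : 0 <= E by rewrite mulr_ge0 ?sqr_ge0 ?expR_ge0.
(* One constant for both cases: [x q <= al / n] enters linearly at a descent and
   quadratically elsewhere. *)
exists (9 * E ^+ 2 * (al + al ^+ 2)).
  by rewrite !(sqr_ge0, mulr_ge0) // addr_ge0 ?sqr_ge0.
near=> n => x y xn xy.
have n1 : 1 <= n%:R :> R by near: n; exact: nbhs_infty_ger.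
have nh : h <= n%:R by near: n; exact: nbhs_infty_ger.
have nE : 4 * al * E <= n%:R by near: n; exact: nbhs_infty_ger.
have n0 : 0 < n%:R :> R by lra.
have n20 : 0 < n%:R ^+ 2 :> R by rewrite exprn_gt0.
set q := h / n%:R ^+ 2.
have q0 : 0 <= q by rewrite divr_ge0 // ltW.
have q01 : 0 <= q <= 1 by rewrite q0 ler_pdivrMr // mul1r; nra.
have xq : x%:R * q <= al / n%:R.
  rewrite /q mulrA ler_pdivrMr // (_ : al / n%:R * n%:R ^+ 2 = al * n%:R).
    by rewrite /al mulrC -mulrA ler_wpM2l // -natrM ler_nat.
  by field; rewrite gt_eqF.
have xq0 : 0 <= x%:R * q by rewrite mulr_ge0.
have hE : (C + 2) ^+ 2 * (1 + q * C) ^+ x <= E.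
  rewrite ler_wpM2l ?sqr_ge0 //.
  apply: (@le_trans _ _ (expR (q * C) ^+ x)).
    by rewrite lerXn2r ?nnegrE ?expR_ge0 ?addr_ge0 ?mulr_ge0 // expR_ge1Dx.
  rewrite -expRM_natl ler_expR.
  rewrite (_ : _ * _ = C * (x%:R * q)); last by ring.
  rewrite ler_wpM2l // (le_trans xq) // ler_pdivrMr //.
  by rewrite ler_peMr.
have hs : 2 * (x%:R * q) * E <= 1 / 2.
  apply: (@le_trans _ _ (2 * (al / n%:R) * E)).
    by rewrite ler_wpM2r // ler_wpM2l.
  rewrite (_ : _ * _ * _ = (2 * al * E) / n%:R); last by ring.
  rewrite ler_pdivrMr //; lra.
have E20 : 0 <= 9 * E ^+ 2 by rewrite mulr_ge0 ?sqr_ge0.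
have [yx|yx] := ltnP y x.
  have ex : x = y.+1 by apply/eqP; rewrite eqn_leq xy yx.
  rewrite ex in xq hE hs xq0 *.
  have [w kw nw] := kernel_step_down R g C q E y g0 gC C0 q01 hE hs.
  exists w; first by rewrite kw /step_base ltnSn expr1 /q; ring.
  apply: near_exp_le nw; rewrite /step_drift ltnSn mulr0 subrr normr0 add0r.
  rewrite -[leRHS]mulrA ler_wpM2l // (le_trans xq) // ler_wpM2r ?invr_ge0 //.
  by rewrite lerDl sqr_ge0.
have ey : y = (x + (y - x))%N by rewrite subnKC.
have [w kw nw] := kernel_step_up R g C q E x (y - x) g0 gC C0 q01 hE hs.
exists w; first by rewrite {1}ey kw /step_base ltnNge yx expr0 mul1r.
apply: near_exp_le nw; rewrite /step_drift ltnNge yx /=.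
rewrite (_ : _ - _ = 0); last by rewrite /q; ring.
rewrite normr0 add0r -[leRHS]mulrA ler_wpM2l //.
apply: (@le_trans _ _ ((al / n%:R) ^+ 2)).
  by rewrite lerXn2r ?nnegrE // (le_trans xq0).
by rewrite exprMn exprVn ler_wpM2r ?invr_ge0 ?(ltW n20) // lerDr.
Unshelve. all: by end_near.
Qed.

(** * The likelihood ratio of a single path *)

Definition descents (n : nat) (x : nat -> nat) : nat :=
  (\sum_(t < n) (x t.+1 < x t))%N.

Definition path_weight {R : realType} (g : nat -> R) (q : R) (n : nat)
  (x : nat -> nat) : R := \prod_(t < n) inar1_kernel q g (x t) (x t.+1).

Lemma path_weight_near (R : realType) (g : nat -> R) (C h : R) (kappa : nat) :
  (forall j, 0 <= g j) -> (forall j, g j.+1 <= C * g j) -> 0 <= C -> 0 <= h ->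
  exists2 E, 0 <= E & \forall n \near \oo, forall x,
    (forall t, (t < n)%N -> (x t <= kappa * n)%N && (x t <= (x t.+1).+1)%N) ->
    exists2 W, path_weight g (h / n%:R ^+ 2) n x =
         h ^+ descents n x * (\prod_(t < n) step_base g n (x t) (x t.+1)) * W &
      near_exp W (h * \sum_(t < n) step_drift g n (x t) (x t.+1))
         (E * ((descents n x)%:R + 1) / n%:R).
Proof.
move=> g0 gC C0 h0.
have [E E0 HE] := kernel_step R g C h kappa g0 gC C0 h0.
exists E => //; near=> n => x hx.
have n0 : 0 < n%:R :> R by near: n; exact: nbhs_infty_gtr.
have step : forall t : 'I_n, exists w, inar1_kernel (h / n%:R ^+ 2) g (x t) (x t.+1) =
     h ^+ (x t.+1 < x t)%N * step_base g n (x t) (x t.+1) * w /\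
      near_exp w (h * step_drift g n (x t) (x t.+1))
        (E * if (x t.+1 < x t)%N then n%:R^-1 else (n%:R ^+ 2)^-1).
  move=> t; have /andP[h1 h2] := hx t (ltn_ord t).
  have [w ? ?] : exists2 w, inar1_kernel (h / n%:R ^+ 2) g (x t) (x t.+1) =
     h ^+ (x t.+1 < x t)%N * step_base g n (x t) (x t.+1) * w &
      near_exp w (h * step_drift g n (x t) (x t.+1))
        (E * if (x t.+1 < x t)%N then n%:R^-1 else (n%:R ^+ 2)^-1).
    by move: (x t) (x t.+1) h1 h2 {hx}; near: n.
  by exists w.
have [w hw] := boolp.choice step.
exists (\prod_(t < n) w t).
  rewrite /path_weight (eq_bigr _ (fun t _ => (hw t).1)) !big_split /=.
  by congr (_ * _ * _); rewrite /descents -expr_sum.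
have := @near_exp_prod R n (fun t => if insub t is Some i then w i else 0)
   (fun t => h * step_drift g n (x t) (x t.+1))
   (fun t => (E * if (x t.+1 < x t)%N then n%:R^-1 else (n%:R ^+ 2)^-1)).
rewrite (eq_bigr (fun t : 'I_n => w t)); last by move=> i _; rewrite valK.
move=> H.
have {}H : near_exp (\prod_(t < n) w t)
    (\sum_(t < n) h * step_drift g n (x t) (x t.+1))
    (\sum_(t < n) E * (if (x t.+1 < x t)%N then n%:R^-1 else (n%:R ^+ 2)^-1)).
  by apply: H => t tn; rewrite insubT; exact: (hw (Ordinal tn)).2.
apply: near_exp_le H; rewrite mulr_sumr subrr normr0 add0r -mulr_sumr.
rewrite -mulrA ler_wpM2l //.
rewrite mulrDl mul1r.
apply: (@le_trans _ _ (\sum_(t < n) ((x t.+1 < x t)%N%:R / n%:R + (n%:R ^+ 2)^-1 : R))).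
  apply: ler_sum => i _; case: ifP => _ /=.
    by rewrite mul1r lerDl invr_ge0 exprn_ge0 // ltW.
  by rewrite mul0r add0r.
rewrite big_split /= -mulr_suml -natr_sum lerD2l.
rewrite sumr_const card_ord -mulr_natr.
by rewrite le_eqVlt; apply/orP; left; apply/eqP; field; rewrite gt_eqF.
Unshelve. all: by end_near.
Qed.

(** The base factors do not depend on the local parameter and cancel; what remains
is a power of [h / h0] counting the descents and the exponential of a weighted
sum of scores. *)
Lemma path_ratio_near (R : realType) (g : nat -> R) (C h h0 : R) (kappa : nat) :
  (forall j, 0 <= g j) -> (forall j, g j.+1 <= C * g j) -> 0 <= C ->
  0 <= h -> 0 <= h0 ->
  exists2 E, 0 <= E & \forall n \near \oo, forall x,
    (forall t, (t < n)%N -> (x t <= kappa * n)%N && (x t <= (x t.+1).+1)%N) ->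
    path_weight g (h0 / n%:R ^+ 2) n x != 0 ->
    exists2 V, path_weight g (h / n%:R ^+ 2) n x /
        path_weight g (h0 / n%:R ^+ 2) n x = (h / h0) ^+ descents n x * V &
      near_exp V ((h - h0) * \sum_(t < n) step_drift g n (x t) (x t.+1))
         (E * ((descents n x)%:R + 1) / n%:R).
Proof.
move=> g0 gC C0 hh hh0.
have [E E0 HE] := path_weight_near R g C h kappa g0 gC C0 hh.
have [E' E0' HE'] := path_weight_near R g C h0 kappa g0 gC C0 hh0.
exists (E + E'); first by rewrite addr_ge0.
near=> n => x hx px.
have [W eW nW] : exists2 W, path_weight g (h / n%:R ^+ 2) n x =
         h ^+ descents n x * (\prod_(t < n) step_base g n (x t) (x t.+1)) * W &
      near_exp W (h * \sum_(t < n) step_drift g n (x t) (x t.+1))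
         (E * ((descents n x)%:R + 1) / n%:R).
  by move: (x) hx {px}; near: n.
have [W' eW' nW'] : exists2 W, path_weight g (h0 / n%:R ^+ 2) n x =
         h0 ^+ descents n x * (\prod_(t < n) step_base g n (x t) (x t.+1)) * W &
      near_exp W (h0 * \sum_(t < n) step_drift g n (x t) (x t.+1))
         (E' * ((descents n x)%:R + 1) / n%:R).
  by move: (x) hx {px eW nW}; near: n.
exists (W / W').
  move: px; rewrite eW eW' !mulf_eq0 !negb_or => /andP[/andP[p1 p2] p3].
  by rewrite expr_div_n; field; rewrite p1 p2 p3.
have := near_expM _ _ _ _ _ _ _ nW (near_expV _ _ _ _ nW').
by apply: near_exp_le; rewrite mulrBl subrr normr0 add0r !mulrDl.
Unshelve. all: by end_near.
Qed.

(** A descent takes at least one death, here [N t] at time [t]. *)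
Lemma descents_le (n : nat) (x e N : nat -> nat) :
  (forall t, (t < n)%N -> (x t.+1 + N t = x t + e t)%N) ->
  (descents n x <= \sum_(t < n) N t)%N.
Proof.
move=> xS; apply: leq_sum => t _.
case: ltnP => //= h; have := xS t (ltn_ord t); lia.
Qed.

Lemma path_lag (n : nat) (x e N : nat -> nat) (t : nat) : x 0%N = 0%N ->
  (forall t, (t < n)%N -> (x t.+1 + N t = x t + e t)%N) ->
  (t <= n)%N -> (x t + \sum_(s < t) N s = \sum_(s < t) e s)%N.
Proof.
move=> x0 xS; elim: t => [_|t IH tn]; first by rewrite !big_ord0 x0.
rewrite !big_ord_recr /=; have := IH (ltnW tn); have := xS t tn.
by move: (\sum_(s < t) N s)%N (\sum_(s < t) e s)%N => a b; lia.
Qed.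

Section drift.
Context (R : realType) (g : nat -> R) (C mu : R).
Hypotheses (g0 : forall j, 0 <= g j) (gC : forall j, g j.+1 <= C * g j).
Hypotheses (C0 : 0 <= C) (mu0 : 0 <= mu).
Local Notation r := (fun k => g k.+1 / g k).

Lemma score_dist k : `|r k - 1| <= C + 1.
Proof.
have r0 : 0 <= r k by rewrite divr_ge0.
have rC : r k <= C.
  have [->|gk] := eqVneq (g k) 0; first by rewrite invr0 mulr0.
  by rewrite ler_pdivrMr // lt0r gk g0.
rewrite ler_norml; apply/andP; split; lra.
Qed.

Context (n kappa : nat) (x e N : nat -> nat).
Hypotheses (n0 : (0 < n)%N) (x0 : x 0%N = 0%N).
Hypothesis xS : forall t, (t < n)%N -> (x t.+1 + N t = x t + e t)%N.
Hypothesis N1 : forall t, (t < n)%N -> (N t <= 1)%N.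
Hypothesis xk : forall t, (t < n)%N -> (x t <= kappa * n)%N.
Local Notation B := ((\sum_(t < n) N t)%N).
Local Notation S := (fun t => (\sum_(s < t) e s)%N).

(** Without a death the increment is the innovation [e t] and only the weight
[x t] has to be compared with [mu t]; at one of the few times with a death the
two terms are bounded separately. *)
Lemma drift_step t : (t < n)%N ->
  `|step_drift g n (x t) (x t.+1) - mu * t%:R * (r (e t) - 1) / n%:R ^+ 2| <=
  (C + 1) / n%:R ^+ 2 *
    (`|(S t)%:R - mu * t%:R| + B%:R + (N t)%:R * ((kappa%:R + mu) * n%:R)).
Proof.
move=> tn.
have n20 : 0 < n%:R ^+ 2 :> R by rewrite exprn_gt0 // ltr0n.
have B0 : (\sum_(s < t) N s <= B)%N.
  rewrite -!(big_mkord xpredT) (big_cat_nat_idem _ (leq0n t) (ltnW tn)) ?leq_addr //.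
have lag := path_lag n x e N t x0 xS (ltnW tn).
have hx := xS t tn; have hN := N1 t tn; have hk := xk t tn.
have tn' : t%:R <= n%:R :> R by rewrite ler_nat ltnW.
have hk' : (x t)%:R <= kappa%:R * n%:R :> R by rewrite -natrM ler_nat.
have C1 : 0 <= (C + 1) / n%:R ^+ 2 by rewrite divr_ge0 ?addr_ge0 // ltW.
have [Nt|Nt] : N t = 0%N \/ N t = 1%N by case: (N t) hN => [|[]]; auto.
  rewrite Nt mul0r addr0.
  have ex : x t.+1 = (x t + e t)%N by lia.
  rewrite /step_drift ex ltnNge leq_addr /= addKn.
  rewrite (_ : _ - _ = ((x t)%:R - mu * t%:R) * ((r (e t) - 1) / n%:R ^+ 2)); last by ring.
  rewrite normrM mulrC ler_pM //.
    rewrite normrM normfV (gtr0_norm n20) ler_wpM2r ?invr_ge0 ?(ltW n20) //.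
    exact: score_dist.
  rewrite (_ : _ - _ = ((S t)%:R - mu * t%:R) - (S t - x t)%:R); last first.
    by rewrite natrB -?lag ?leq_addr //; ring.
  apply: le_trans (ler_normB _ _) _; rewrite lerD2l ger0_norm // ler_nat.
  by rewrite -lag addKn.
rewrite Nt mul1r.
apply: le_trans (ler_normB _ _) _.
have h1 : `|step_drift g n (x t) (x t.+1)| <= (C + 1) / n%:R ^+ 2 * (kappa%:R * n%:R).
  rewrite /step_drift; case: ifP => _.
    by rewrite normr0 mulr_ge0 // mulr_ge0.
  rewrite normrM [leRHS]mulrAC -[leRHS]mulrA [leRHS]mulrC ler_pM ?score_dist //.
  by rewrite ger0_norm ?divr_ge0 ?(ltW n20) // ler_wpM2r // invr_ge0 ltW.
have h2 : `|mu * t%:R * (r (e t) - 1) / n%:R ^+ 2| <= (C + 1) / n%:R ^+ 2 * (mu * n%:R).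
  rewrite mulrAC normrM [leRHS]mulrAC -[leRHS]mulrA [leRHS]mulrC ler_pM ?score_dist //.
  rewrite ger0_norm ?divr_ge0 ?mulr_ge0 ?(ltW n20) // ler_wpM2r ?invr_ge0 ?(ltW n20) //.
  by rewrite ler_wpM2l.
apply: le_trans (lerD h1 h2) _.
rewrite -mulrDr ler_wpM2l // -mulrDl lerDr addr_ge0 //.
Qed.

(** The weights [x t] are replaced by [mu t] and the increments by the innovations;
then the centred scores average out, and their mean [- g 0] gives
[- mu g(0) / 2] because [mu * sum_(t < n) t] is of order [mu n ^ 2 / 2]. The
absolute deviations are controlled by their squares through
[|M| <= M ^ 2 / (eta n) + eta n]. *)
Lemma drift_sum_near (eta : R) : 0 < eta ->
  \sum_(t < n) ((S t)%:R - mu * t%:R) ^+ 2 <= eta ^+ 2 * n%:R ^+ 3 ->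
  B%:R <= eta * n%:R ->
  `|\sum_(t < n) t%:R * (r (e t) - (1 - g 0%N))| <= eta * n%:R ^+ 2 ->
  `|\sum_(t < n) step_drift g n (x t) (x t.+1) + mu * g 0%N / 2| <=
     ((C + 1) * (3 + kappa%:R + mu) + mu) * eta + mu * g 0%N / 2 / n%:R.
Proof.
move=> eta0 hM hB hr.
have n00 : 0 < n%:R :> R by rewrite ltr0n.
have n20 : 0 < n%:R ^+ 2 :> R by rewrite exprn_gt0.
have C1 : 0 <= (C + 1) / n%:R ^+ 2 by rewrite divr_ge0 ?addr_ge0 // ltW.
have hA : \sum_(t < n) `|(S t)%:R - mu * t%:R| <= 2 * eta * n%:R ^+ 2.
  apply: (@le_trans _ _ (\sum_(t < n) (((S t)%:R - mu * t%:R) ^+ 2 / (eta * n%:R)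
      + eta * n%:R))).
    apply: ler_sum => t _; set M := _ - _.
    have en : 0 < eta * n%:R by rewrite mulr_gt0.
    rewrite -(ler_pM2r en) mulrDl divfK ?gt_eqF //.
    rewrite -[M ^+ 2]real_normK ?num_real //.
    by have := normr_ge0 M; nra.
  rewrite big_split /= sumr_const card_ord -mulr_suml -[eta * _ *+ n]mulr_natr.
  apply: (@le_trans _ _ (eta ^+ 2 * n%:R ^+ 3 / (eta * n%:R) + eta * n%:R * n%:R)).
    by rewrite lerD2r ler_wpM2r // invr_ge0 mulr_ge0 // ltW.
  by rewrite le_eqVlt; apply/orP; left; apply/eqP; field; rewrite !gt_eqF.
have h1 : `|\sum_(t < n) step_drift g n (x t) (x t.+1) -
    \sum_(t < n) mu * t%:R * (r (e t) - 1) / n%:R ^+ 2| <=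
    (C + 1) * (3 + kappa%:R + mu) * eta.
  rewrite -sumrB (le_trans (ler_norm_sum _ _ _)) //.
  apply: (@le_trans _ _ (\sum_(t < n) (C + 1) / n%:R ^+ 2 *
    (`|(S t)%:R - mu * t%:R| + B%:R + (N t)%:R * ((kappa%:R + mu) * n%:R)))).
    by apply: ler_sum => t _; exact: drift_step.
  rewrite -mulr_sumr !big_split /= sumr_const card_ord -mulr_suml -natr_sum.
  rewrite -[_%:R *+ n]mulr_natr.
  apply: (@le_trans _ _ ((C + 1) / n%:R ^+ 2 * (2 * eta * n%:R ^+ 2 +
     eta * n%:R * n%:R + eta * n%:R * ((kappa%:R + mu) * n%:R)))).
    rewrite ler_wpM2l //; apply: lerD.
      by apply: lerD => //; rewrite ler_wpM2r.
    by rewrite ler_wpM2r // mulr_ge0 ?addr_ge0.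
  by rewrite le_eqVlt; apply/orP; left; apply/eqP; field; rewrite !gt_eqF.
have sumt : \sum_(t < n) (t%:R : R) = n%:R * (n%:R - 1) / 2.
  elim: (n) => [|m IH]; first by rewrite big_ord0 mul0r mul0r.
  by rewrite big_ord_recr /= IH -natr1; field.
have h2 : \sum_(t < n) mu * t%:R * (r (e t) - 1) / n%:R ^+ 2 + mu * g 0%N / 2 =
   mu / n%:R ^+ 2 * (\sum_(t < n) t%:R * (r (e t) - (1 - g 0%N)))
   + mu * g 0%N / 2 / n%:R.
  have -> : \sum_(t < n) mu * t%:R * (r (e t) - 1) / n%:R ^+ 2 =
     mu / n%:R ^+ 2 * (\sum_(t < n) t%:R * (r (e t) - (1 - g 0%N)))
      - mu * g 0%N / n%:R ^+ 2 * (\sum_(t < n) (t%:R : R)).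
    rewrite !mulr_sumr -sumrB; apply: eq_bigr => i _; ring.
  by rewrite sumt; field; rewrite gt_eqF.
rewrite -[X in `|X + _|](subrK (\sum_(t < n) mu * t%:R * (r (e t) - 1) / n%:R ^+ 2)).
rewrite -addrA h2 [in leRHS]mulrDl -[leRHS]addrA.
apply: le_trans (ler_normD _ _) _; apply: lerD h1 _.
rewrite (le_trans (ler_normD _ _)) //.
rewrite (@ger0_norm _ (mu * g 0%N / 2 / n%:R)); last first.
  by rewrite !divr_ge0 ?mulr_ge0.
rewrite lerD2r normrM ger0_norm ?divr_ge0 ?(ltW n20) //.
rewrite -mulrA ler_wpM2l // mulrC ler_pdivrMr //.
Qed.

End drift.

(** The whole argument for one path: all randomness is in the hypotheses, which are
shown later to fail with probability [O(1 / n)]. *)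
Lemma likelihood_near (R : realType) (g : nat -> R) (C mu h h0 : R) (kappa : nat) :
  (forall j, 0 <= g j) -> (forall j, g j.+1 <= C * g j) -> 0 <= C -> 0 <= mu ->
  0 <= h -> 0 <= h0 ->
  exists2 A, 0 <= A & \forall n \near \oo, forall (eta : R) (x e N : nat -> nat),
    0 < eta -> x 0%N = 0%N ->
    (forall t, (t < n)%N -> (x t.+1 + N t = x t + e t)%N) ->
    (forall t, (t < n)%N -> (N t <= 1)%N) ->
    (forall t, (t < n)%N -> (x t <= kappa * n)%N) ->
    \sum_(t < n) ((\sum_(s < t) e s)%N%:R - mu * t%:R) ^+ 2 <= eta ^+ 2 * n%:R ^+ 3 ->
    (\sum_(t < n) N t)%N%:R <= eta * n%:R ->
    `|\sum_(t < n) t%:R * (g (e t).+1 / g (e t) - (1 - g 0%N))| <= eta * n%:R ^+ 2 ->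
    path_weight g (h0 / n%:R ^+ 2) n x != 0 ->
    exists2 V, path_weight g (h / n%:R ^+ 2) n x /
        path_weight g (h0 / n%:R ^+ 2) n x = (h / h0) ^+ descents n x * V &
      near_exp V (- ((h - h0) * g 0%N * mu / 2)) (A * (eta + n%:R^-1)).
Proof.
move=> g0 gC C0 mu0 hh hh0.
have [E E0 HE] := path_ratio_near R g C h h0 kappa g0 gC C0 hh hh0.
pose A1 := (C + 1) * (3 + kappa%:R + mu) + mu.
have A10 : 0 <= A1 by rewrite /A1 !(addr_ge0, mulr_ge0).
have c0 : 0 <= mu * g 0%N / 2 by rewrite !mulr_ge0.
exists (`|h - h0| * (A1 + mu * g 0%N / 2) + E).
  by apply: addr_ge0 => //; apply: mulr_ge0 => //; exact: addr_ge0.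
near=> n => eta x e N eta0 x0 xS N1 xk hM hB hr px.
have n0 : (0 < n)%N by near: n; exact: nbhs_infty_gt.
have n00 : 0 < n%:R :> R by rewrite ltr0n.
have [V eV nV] : exists2 V, path_weight g (h / n%:R ^+ 2) n x /
        path_weight g (h0 / n%:R ^+ 2) n x = (h / h0) ^+ descents n x * V &
      near_exp V ((h - h0) * \sum_(t < n) step_drift g n (x t) (x t.+1))
         (E * ((descents n x)%:R + 1) / n%:R).
  have hx t : (t < n)%N -> (x t <= kappa * n)%N && (x t <= (x t.+1).+1)%N.
    move=> tn; rewrite xk //= -addn1 (leq_trans (leq_addr (e t) _)) //.
    by rewrite -xS // leq_add2l N1.
  by move: (x) hx px {x0 xS xk}; near: n.
exists V => //; apply: near_exp_le nV.
have h1 := drift_sum_near R g C mu g0 gC C0 mu0 n kappa x e N n0 x0 xS N1 xk eta eta0 hM hB hr.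
have h2 := descents_le n x e N xS.
set W := \sum_(t < n) step_drift _ _ _ _ in h1 *.
rewrite (_ : _ - _ = (h - h0) * (W + mu * g 0%N / 2)); last by ring.
rewrite normrM.
have h3 : E * ((descents n x)%:R + 1) / n%:R <= E * (eta + n%:R^-1).
  rewrite -mulrA ler_wpM2l // mulrDl mul1r lerD2r ler_pdivrMr //.
  by apply: le_trans hB; rewrite ler_nat.
rewrite [leRHS]mulrDl; apply: lerD _ h3; rewrite -[leRHS]mulrA ler_wpM2l //.
apply: le_trans h1 _; rewrite -/A1.
have ni : 0 <= n%:R^-1 :> R by rewrite invr_ge0 ltW.
have := mulr_ge0 A10 ni; have := mulr_ge0 c0 (ltW eta0); lra.
Unshelve. all: by end_near.
Qed.

(** * The law of a path *)

Lemma unzip1_functional (I V : eqType) (s : seq (I * V)) (i : I) (v v' : V) :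
  uniq (unzip1 s) -> (i, v) \in s -> (i, v') \in s -> v = v'.
Proof.
elim: s => [//|[j u] s IH] /= /andP[js us]; rewrite !inE !xpair_eqE.
move=> /orP[/andP[/eqP ei /eqP ev]|iv] /orP[/andP[/eqP ei' /eqP ev']|iv'].
- by rewrite ev ev'.
- by case/negP: js; rewrite -ei; apply/mapP; exists (i, v').
- by case/negP: js; rewrite -ei'; apply/mapP; exists (i, v).
- exact: IH.
Qed.

Section cylinder.
Context {d d' : measure_display} {T : measurableType d} {V : measurableType d'}.
Context {I : choiceType}.
Variable X : I -> {mfun T >-> V}.
Hypothesis mV : forall A : set V, measurable A.

(** Finitely many prescribed values. Lists of pairs keep the events closed under
prescribing one more value, which is what the induction on the path needs. *)
Definition cylinder (s : seq (I * V)) : set T :=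
  [set w | all (fun p => X p.1 w == p.2) s].

Lemma cylinderE s : uniq (unzip1 s) -> cylinder s =
  \bigcap_(i in [set` unzip1 s]) X i @^-1` [set v | (i, v) \in s].
Proof.
move=> us; apply/seteqP; split=> w.
  move=> /allP h i /= /mapP[[j v] js ->] /=.
  by rewrite (eqP (h _ js)).
move=> h; apply/allP => -[i v] iv /=; apply/eqP.
by apply: (@unzip1_functional _ _ s i) => //; exact: h (map_f fst iv).
Qed.

Lemma measurable_cylinder s : measurable (cylinder s).
Proof.
elim: s => [|p s IH].
  by rewrite (_ : cylinder _ = setT) //; apply/seteqP.
rewrite (_ : cylinder _ = X p.1 @^-1` [set p.2] `&` cylinder s).
  apply: measurableI => //; rewrite -[X in measurable X]setTI.
  exact: measurable_funPT.
apply/seteqP; split=> w /=.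
  by move=> /andP[/eqP].
by move=> [pw cw]; apply/andP; split; [exact/eqP|exact: cw].
Qed.

Lemma cylinder_sigma_family s : sigma_family (fun i => X i : T -> V) (cylinder s).
Proof.
pose GG := [set E | exists (i : I) B, measurable B /\ E = X i @^-1` B].
rewrite -[sigma_family _]/(@measurable _ (g_sigma_algebraType GG)).
elim: s => [|p s IH].
  by rewrite (_ : cylinder _ = setT); [exact: measurableT|apply/seteqP].
rewrite (_ : cylinder _ = X p.1 @^-1` [set p.2] `&` cylinder s).
  apply: (@measurableI _ (g_sigma_algebraType GG)) => //.
  by apply: sub_sigma_algebra; exists p.1, [set p.2].
apply/seteqP; split=> w /=.
  by move=> /andP[/eqP].
by move=> [pw cw]; apply/andP; split; [exact/eqP|exact: cw].
Qed.

Lemma cylinder_prob (R : realType) (P : probability T R) s :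
  mutual_independence P (fun i => X i : T -> V) -> uniq (unzip1 s) ->
  P (cylinder s) = (\prod_(p <- s) P (X p.1 @^-1` [set p.2]))%E.
Proof.
move=> ind us; rewrite (cylinderE s us) ind // big_map.
apply: eq_big_seq => -[i v] iv /=; congr (P _).
apply/seteqP; split=> w /=; last by move=> ->.
by move=> iXw; exact: (@unzip1_functional _ _ s i).
Qed.

End cylinder.

Section path_law.
Context {R : realType} {d : measure_display} {T : measurableType d}.
Variables (P : probability T R) (theta : R) (G : probability nat R).
Variables (Z : nat -> nat -> {mfun T >-> bool}) (eps : nat -> {mfun T >-> nat}).
Hypothesis theta01 : 0 <= theta <= 1.
Hypothesis noise : inar1_noise P theta G Z eps.

Local Notation X := (inar1 (fun s j => Z s j) (fun s => eps s)).
Local Notation Zc := (cylinder (fun tj : nat * nat => Z tj.1 tj.2)).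
Local Notation Ec := (cylinder eps).

Lemma distributionE d' (V : measurableType d') (Y : {mfun T >-> V}) (A : set V) :
  distribution P Y A = P (Y @^-1` A).
Proof. by []. Qed.

Lemma thinning_prob t j b : P (Z t j @^-1` [set b]) = (bernoulli_pmf theta b)%:E.
Proof.
rewrite -distributionE (thinning_law noise) /bernoulli_prob theta01.
by rewrite fsbig_set1.
Qed.

Lemma innovation_prob t (A : set nat) : P (eps t @^-1` A) = G A.
Proof. by rewrite -distributionE (innovation_law noise). Qed.

Lemma massE (d' : measure_display) (V : measurableType d') (Q : probability V R) x :
  measurable [set x] -> (mass Q x)%:E = Q [set x].
Proof. by move=> mx; rewrite /mass fineK // fin_num_measure. Qed.

Lemma noise_cylinder_prob s s' : uniq (unzip1 s) -> uniq (unzip1 s') ->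
  P (Zc s `&` Ec s') =
  ((\prod_(p <- s) bernoulli_pmf theta p.2) * (\prod_(p <- s') mass G p.2))%:E.
Proof.
move=> us us'; rewrite (thinning_innovation_indep noise); last 2 first.
- exact: cylinder_sigma_family.
- exact: cylinder_sigma_family.
rewrite (@cylinder_prob _ _ _ _ _ (fun tj : nat * nat => Z tj.1 tj.2)) //; last first.
  exact: thinning_indep noise.
rewrite (cylinder_prob eps) //; last exact: innovation_indep noise.
rewrite EFinM -!prodEFin; congr (_ * _)%E.
  by apply: eq_bigr => p _; rewrite thinning_prob.
by apply: eq_bigr => p _; rewrite innovation_prob massE.
Qed.

Definition path_event n (x : nat -> nat) : set T :=
  [set w | forall i, (i <= n)%N -> X i w = x i].

Lemma path_event0 x : path_event 0 x = if x 0%N == 0%N then setT else set0.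
Proof.
apply/seteqP; split=> w.
  by move=> /(_ 0%N (leqnn _)) /= <-.
by case: eqP => // x0 _ i; rewrite leqn0 => /eqP ->.
Qed.

Lemma path_eventS n x : path_event n.+1 x = path_event n x `&`
  [set w | (\sum_(j < x n) Z n j w + eps n w = x n.+1)%N].
Proof.
apply/seteqP; split=> w.
  move=> h; split=> [i im|]; first exact/h/leqW.
  by rewrite /= -(h n (leqnSn n)) -(h n.+1 (leqnn _)).
move=> [h1 h2] i; rewrite leq_eqVlt => /orP[/eqP ->|]; last exact: h1.
by rewrite /= (h1 n (leqnn n)).
Qed.

(** The next state when [m] particles are present; letting [m] grow one by one
matches the recursion of [inar1_kernel]. *)
Definition thinned n m (w : T) := (\sum_(j < m) Z n j w + eps n w)%N.

Lemma measurable_thinned n m y : measurable [set w | thinned n m w = y].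
Proof.
elim: m y => [|m IH] y.
  rewrite (_ : [set _ | _] = eps n @^-1` [set y]).
    by rewrite -[X in measurable X]setTI; exact: measurable_funPT.
  by apply/seteqP; split=> w; rewrite /= /thinned big_ord0.
have mZ b : measurable (Z n m @^-1` [set b]).
  by rewrite -[X in measurable X]setTI; exact: measurable_funPT.
rewrite (_ : [set _ | _] =
  (Z n m @^-1` [set false] `&` [set w | thinned n m w = y]) `|`
  (Z n m @^-1` [set true] `&` if y is y'.+1 then [set w | thinned n m w = y'] else set0)).
  apply: measurableU; apply: measurableI => //.
  by case: y.
apply/seteqP; split=> w; rewrite /= /thinned big_ord_recr /=.
  case: (Z n m w) => /=; rewrite ?addn0 => h; [right|by left].
  by split=> //; move: h; case: (y) => [|y'] /=; lia.
case=> [[-> h]|[-> ]] /=; first by rewrite addn0.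
by case: (y) => [|y'] //=; lia.
Qed.

Lemma measurable_path_event n x : measurable (path_event n x).
Proof.
elim: n => [|n IH]; first by rewrite path_event0; case: ifP.
by rewrite path_eventS; apply: measurableI => //; exact: measurable_thinned.
Qed.

Lemma measurable_noise_cylinder s s' : measurable (Zc s `&` Ec s').
Proof. by apply: measurableI; apply: measurable_cylinder. Qed.

Local Notation K := (inar1_kernel (1 - theta) (mass G)).
Local Notation weight n x :=
  ((x 0%N == 0%N)%:R * path_weight (mass G) (1 - theta) n x).
Local Notation cprod s s' :=
  ((\prod_(p <- s) bernoulli_pmf theta p.2) * (\prod_(p <- s') mass G p.2)).

(** One step of the Markov property, proved by revealing the particles one at a
time: the value of the last thinning variable is moved to the list of prescribed
values. Carrying arbitrary prescribed values of variables that the past has not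
used is what makes the induction go through. *)
Lemma thinned_event_prob n x :
  (forall s s', uniq (unzip1 s) -> uniq (unzip1 s') ->
    (forall p, p \in s -> (n <= p.1.1)%N) -> (forall p, p \in s' -> (n <= p.1)%N) ->
    P (path_event n x `&` (Zc s `&` Ec s')) = (weight n x * cprod s s')%:E) ->
  forall m y s s', uniq (unzip1 s) -> uniq (unzip1 s') ->
    (forall p, p \in s -> (n < p.1.1)%N || (p.1.1 == n) && (m <= p.1.2)%N) ->
    (forall p, p \in s' -> (n < p.1)%N) ->
    P (path_event n x `&` [set w | thinned n m w = y] `&` (Zc s `&` Ec s')) =
      (weight n x * K m y * cprod s s')%:E.
Proof.
move=> IHn; elim=> [|m IH] y s s' us us' hs hs'.
  rewrite (_ : _ `&` _ = path_event n x `&` (Zc s `&` Ec ((n, y) :: s'))).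
    rewrite IHn //=; first by rewrite big_cons /=; congr EFin; ring.
    - rewrite us' andbT; apply/negP => /mapP[[a b] /hs' /= h e]; lia.
    - by move=> [[a b] c] /hs /=; lia.
    - by move=> p; rewrite inE => /orP[/eqP -> //|/hs' /ltnW].
  rewrite -setIA; congr (_ `&` _); apply/seteqP; split=> w.
    move=> [h1 [h2 h3]]; split=> //; apply/andP; split; last exact: h3.
    by apply/eqP; rewrite -h1 /thinned big_ord0.
  move=> [h2 /andP[/eqP h1 h3]]; split; last by split.
  by rewrite /= /thinned big_ord0.
pose Ev y := path_event n x `&` [set w | thinned n m w = y].
have mEv z : measurable (Ev z).
  by apply: measurableI; [exact: measurable_path_event|exact: measurable_thinned].
pose s1 b := ((n, m), b) :: s.
have us1 b : uniq (unzip1 (s1 b)).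
  by rewrite /= us andbT; apply/negP => /mapP[[[a1 a2] b'] /hs /= h [ea eb]]; lia.
have hs1 b p : p \in s1 b -> (n < p.1.1)%N || (p.1.1 == n) && (m <= p.1.2)%N.
  by rewrite inE => /orP[/eqP -> /=|/hs]; lia.
pose A b z := Ev z `&` (Zc (s1 b) `&` Ec s').
have mA b z : measurable (A b z).
  by apply: measurableI => //; exact: measurable_noise_cylinder.
have PA b z : P (A b z) = (weight n x * K m z *
    (bernoulli_pmf theta b * cprod s s'))%:E.
  rewrite (IH _ _ _ (us1 b) us' (hs1 b) hs').
  by rewrite big_cons /= !mulrA.
rewrite (_ : _ `&` _ = A false y `|` if y is y'.+1 then A true y' else set0).
  set E := (if y is _.+1 then _ else _).
  have -> : P (A false y `|` E) = (P (A false y) + P E)%E.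
    apply: measureU => //; first by rewrite /E; case: (y).
    apply/seteqP; split=> w //; rewrite /E; case: (y) => [[]//|y'].
    move=> [[_ [/andP[/eqP zf _] _]] [_ [/andP[/eqP zt _] _]]].
    by move: zt; rewrite /= in zf *; rewrite zf.
  have -> : P E =
     (weight n x * (if y is y'.+1 then K m y' else 0) * (theta * cprod s s'))%:E.
    by rewrite /E; case: (y) => [|y']; rewrite ?measure0 ?PA // mulr0 mul0r.
  by rewrite PA -EFinD /= /bernoulli_pmf; congr EFin; case: (y) => [|y0]; ring.
apply/seteqP; split=> w.
  move=> [[h1 h2] [h3 h4]]; move: h2; rewrite /= /thinned big_ord_recr /=.
  case zw : (Z n m w) => /= h2; [right|left].
    case: (y) h2 => [|y']; rewrite ?addn1 => h2; first by exfalso; lia.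
    split; first by split=> //; apply: succn_inj; rewrite -h2.
    by split=> //; apply/andP; split; [exact/eqP|exact: h3].
  split; first by split=> //; rewrite /= -h2 addn0.
  by split=> //; apply/andP; split; [exact/eqP|exact: h3].
case.
  move=> [[h1 h2] [/andP[/eqP zw h3] h4]]; split=> //; split=> //.
  by move: h2; rewrite /= /thinned big_ord_recr /=; rewrite zw addn0.
case: (y) => [[]|y'] [[h1 h2] [/andP[/eqP zw h3] h4]]; split=> //; split=> //.
by rewrite /= /thinned big_ord_recr /= zw addn1 addSn; congr S; exact: h2.
Qed.

(** The prescribed values [s] and [s'] concern times from [n] on; they are a
strengthening for the induction on [n]. *)
Lemma path_event_prob n x s s' : uniq (unzip1 s) -> uniq (unzip1 s') ->
  (forall p, p \in s -> (n <= p.1.1)%N) -> (forall p, p \in s' -> (n <= p.1)%N) ->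
  P (path_event n x `&` (Zc s `&` Ec s')) = (weight n x * cprod s s')%:E.
Proof.
elim: n s s' => [|n IH] s s' us us' hs hs'.
  rewrite path_event0 /path_weight big_ord0 mulr1; case: eqP => _.
    by rewrite setTI mul1r noise_cylinder_prob.
  by rewrite set0I measure0 mul0r.
rewrite path_eventS (thinned_event_prob n x IH) //.
  by rewrite /path_weight big_ord_recr /= !mulrA.
by move=> p /hs ->.
Qed.

End path_law.

Lemma mass_inar1_law (R : realType) (d : measure_display) (T : measurableType d)
    (P : R -> probability T R)
    (Z : nat -> nat -> {mfun T >-> bool}) (eps : nat -> {mfun T >-> nat})
    (G : probability nat R) (theta : R) (n : nat) (x : n.+1.-tuple nat) :
  0 <= theta <= 1 -> inar1_noise (P theta) theta G Z eps ->
  mass (inar1_law Z eps P n theta) x =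
  (nth 0%N x 0 == 0%N)%:R * path_weight (mass G) (1 - theta) n (nth 0%N x).
Proof.
move=> t01 noise.
rewrite /mass -[X in fine X]/(P theta (inar1_path Z eps n @^-1` [set x])).
have h := path_event_prob _ _ _ _ _ t01 noise n (nth 0%N x) [::] [::] isT isT.
rewrite !big_nil !mulr1 in h.
rewrite (_ : _ @^-1` _ = path_event Z eps n (nth 0%N x) `&`
  (cylinder (fun tj : nat * nat => Z tj.1 tj.2) [::] `&` cylinder eps [::])).
  by rewrite h.
apply/seteqP; split=> w.
  move=> /= <-; split; last by split.
  by move=> i ni; rewrite (nth_mktuple _ _ (Ordinal (ni : (i < n.+1)%N))).
move=> [h1 _] /=; apply: eq_from_tnth => i; rewrite tnth_mktuple.
by rewrite h1 ?(tnth_nth 0%N) // -ltnS.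
Qed.

(** * Second moments of sums of independent innovations *)

Lemma measurable_superlevel (d : measure_display) (T : measurableType d)
    (R : realType) (F : T -> R) (a : R) :
  measurable_fun setT F -> measurable [set w | a <= F w].
Proof.
move=> mF; rewrite (_ : [set _ | _] = F @^-1` `[a, +oo[).
  by rewrite -[X in measurable X]setTI; apply: mF => //; exact: measurable_itv.
by apply/seteqP; split=> w; rewrite /= in_itv /= andbT.
Qed.

Lemma markov_bound (d : measure_display) (T : measurableType d) (R : realType)
    (P : probability T R) (F : T -> R) (a b : R) :
  measurable_fun setT F -> (forall w, 0 <= F w) -> 0 < a ->
  (\int[P]_w (F w)%:E <= b%:E)%E -> (P [set w | (a <= F w)%R] <= (b / a)%:E)%E.
Proof.
move=> mF F0 a0 Fb; rewrite EFinM lee_pdivlMr // muleC.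
have mA := measurable_superlevel _ _ _ F a mF.
apply: le_trans Fb.
have mF' D : measurable D -> measurable_fun D (fun w => (F w)%:E).
  by move=> mD; apply/measurable_EFinP; exact: measurable_funTS.
apply: (@le_trans _ _ (\int[P]_(w in [set w | (a <= F w)%R]) (F w)%:E)%E); last first.
  apply: ge0_subset_integral => //; first exact: mF'.
  by move=> w _; rewrite lee_fin.
rewrite -integral_cst //; apply: ge0_le_integral => //.
- by move=> w _; rewrite lee_fin ltW.
- exact: mF'.
Qed.

Section second_moment.
Context {R : realType} {d : measure_display} {T : measurableType d}.
Variables (P : probability T R) (G : probability nat R).
Variable X : nat -> {mfun T >-> nat}.
Hypothesis lawX : forall t A, P (X t @^-1` A) = G A.
Hypothesis indX : forall s t A B, s != t ->
  P (X s @^-1` A `&` X t @^-1` B) = (G A * G B)%E.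
Variable psi : nat -> R.
Hypothesis psi2 : G.-integrable setT (fun k => (psi k ^+ 2)%:E).
Hypothesis psi0 : (\int[G]_k (psi k)%:E = 0)%E.

Local Notation v := (fine (\int[G]_k (psi k ^+ 2)%:E)%E).

Let intf (f : nat -> \bar R) t : (forall k, 0 <= f k)%E ->
  (\int[P]_w f (X t w) = \int[G]_k f k)%E.
Proof.
move=> f0; rewrite -(@ge0_integral_distribution _ _ _ _ _ P (X t)) //.
by apply: eq_measure_integral => A mA _; exact: lawX.
Qed.

Let mX (f : nat -> R) t : measurable_fun setT (fun w => f (X t w)).
Proof. exact: (@measurableT_comp _ _ _ _ _ _ f). Qed.

Let int_sq t : P.-integrable setT (fun w => (psi (X t w) ^+ 2)%:E).
Proof.
apply/integrableP; split.
  by apply/measurable_EFinP; exact: (mX (fun k => psi k ^+ 2)).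
rewrite (intf (fun k => `|(psi k ^+ 2)%:E|)%E) //.
by case/integrableP: psi2.
Qed.

Let int_psi : G.-integrable setT (fun k => (psi k)%:E).
Proof.
apply: (@le_integrable _ _ _ G setT _ _ (fun k => (1 + psi k ^+ 2)%:E)) => //.
  move=> k _; rewrite !abse_EFin lee_fin.
  rewrite [leRHS]ger0_norm ?addr_ge0 ?sqr_ge0 //.
  rewrite -[psi k ^+ 2]real_normK ?num_real //.
  have := normr_ge0 (psi k); nra.
under eq_fun do rewrite EFinD.
apply: integrableD => //; exact: finite_measure_integrable_cst.
Qed.

Let int_prod s t :
  P.-integrable setT (fun w => (psi (X s w) * psi (X t w))%:E).
Proof.
apply: (@le_integrable _ _ _ P setT _ _
   (fun w => (psi (X s w) ^+ 2 + psi (X t w) ^+ 2)%:E)) => //.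
- by apply/measurable_EFinP; apply: measurable_funM; exact: mX.
- move=> w _; rewrite !abse_EFin lee_fin.
  rewrite [leRHS]ger0_norm ?addr_ge0 ?sqr_ge0 // normrM.
  rewrite -[psi (X s w) ^+ 2]real_normK ?num_real //.
  rewrite -[psi (X t w) ^+ 2]real_normK ?num_real //.
  have := normr_ge0 (psi (X s w)); have := normr_ge0 (psi (X t w)); nra.
under eq_fun do rewrite EFinD.
by apply: integrableD => //; exact: int_sq.
Qed.

(** The joint law of two innovations is the product measure, and Fubini's theorem
factors the expectation. *)
Lemma integral_uncorrelated s t : s != t ->
  (\int[P]_w (psi (X s w) * psi (X t w))%:E = 0)%E.
Proof.
move=> st.
pose XY w := (X s w, X t w).
have mXY : measurable_fun setT XY by apply: measurable_fun_pair.
pose f (p : nat * nat) := (psi p.1 * psi p.2)%:E.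
have mf : measurable_fun setT f.
  by apply/measurable_EFinP; apply: measurable_funM; apply: measurableT_comp.
pose XYm : {mfun T >-> (nat * nat)%type} := HB.pack_for {mfun T >-> (nat * nat)%type} XY
  (isMeasurableFun.Build _ _ _ _ XY mXY).
transitivity (\int[distribution P XYm]_p f p)%E.
  by rewrite integral_distribution //; exact: int_prod.
rewrite (eq_measure_integral (G \x G)%E); last first.
  move=> A mA _; symmetry.
  apply: (@product_measure_unique _ _ _ _ R G G (distribution P XYm)) => // B C _ _.
  by rewrite -(indX _ _ _ _ st).
have fi : (G \x G)%E.-integrable setT f.
  apply/integrable12ltyP => //.
  under eq_integral => a _.
    under eq_integral => b _ do rewrite /f /= normrM EFinM.
    rewrite ge0_integralZl_EFin //.
    over.
  rewrite ge0_integralZr //; last by apply: integral_ge0.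
  by case/integrableP: int_psi => _ h; rewrite lte_mul_pinfty // ?integral_ge0 // ge0_fin_numE // integral_ge0.
rewrite -integral12_prod_meas1 // /fubini_F.
under eq_integral => a _.
  under eq_integral => b _ do rewrite /f /= EFinM.
  rewrite integralZl // psi0 mule0.
  over.
by rewrite integral0.
Qed.

Lemma integral_weighted_sum_sq (a : nat -> R) n :
  (\int[P]_w ((\sum_(s < n) a s * psi (X s w)) ^+ 2)%:E =
   ((\sum_(s < n) a s ^+ 2) * v)%:E)%E.
Proof.
have vE t : (\int[P]_w (psi (X t w) ^+ 2)%:E = v%:E)%E.
  rewrite (intf (fun k => (psi k ^+ 2)%:E)); last by move=> k; rewrite lee_fin sqr_ge0.
  by rewrite fineK // integrable_fin_num.
under eq_integral => w _.
  rewrite expr2 big_distrlr /= pair_big /= -sumEFin.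
  under eq_bigr do rewrite mulrACA EFinM.
  over.
rewrite integral_sum //; last by move=> p; apply: integrableZl => //; exact: int_prod.
rewrite (eq_bigr (fun p : 'I_n * 'I_n => (if p.1 == p.2 then a p.1 ^+ 2 * v else 0)%:E)); last first.
  move=> [s t] _ /=; rewrite integralZl //.
  have [->|st] := eqVneq s t.
    under eq_integral do rewrite -expr2.
    by rewrite vE -EFinM expr2.
  by rewrite integral_uncorrelated ?mule0.
rewrite sumEFin -(pair_bigA _ (fun s t : 'I_n => if s == t then a s ^+ 2 * v else 0)) /=.
congr EFin; rewrite mulr_suml; apply: eq_bigr => s _.
by rewrite -big_mkcond /= (big_pred1 s) // => t; rewrite eq_sym.
Qed.

End second_moment.

(** * Moments and mass ratios of the innovation law *)

Lemma mass_ge0 d (T : measurableType d) (R : realType) (Q : probability T R) x :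
  0 <= mass Q x.
Proof. exact: fine_ge0. Qed.

Lemma ge0_integral_mass (R : realType) (G : probability nat R) (f : nat -> R) :
  (forall k, 0 <= f k) ->
  (\int[G]_k (f k)%:E = \sum_(k <oo) (f k * mass G k)%:E)%E.
Proof.
move=> f0.
have -> : [set: nat] = \bigcup_k [set k].
  by apply/seteqP; split=> // k _; exists k.
rewrite ge0_integral_bigcup //; last 2 first.
- by move=> k _; rewrite lee_fin.
- by apply/trivIsetP => i j _ _ ij; apply/seteqP; split=> // k [/= -> /eqP]; rewrite (negbTE ij).
apply: eq_eseriesr => k _.
rewrite (eq_integral (cst (f k)%:E)); last by move=> j; rewrite inE => /= ->.
by rewrite integral_cst // EFinM massE.
Qed.

(** The score is bounded: ratios of successive masses are at most one from some
index on, and below that index the masses are positive. *)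
Lemma mass_ratio_bound (R : realType) (G : probability nat R) : assumption_G G ->
  exists2 C, 0 <= C & forall k, mass G k.+1 <= C * mass G k.
Proof.
move=> hG.
have [M [gM1 gM2]] : exists M, (forall k, (k < M)%N -> 0 < mass G k) /\
    (forall k, (M <= k)%N -> mass G k.+1 <= mass G k).
  case: hG => [[M [_ sG]]|[sG _ [M [_ hM]]]]; exists M; split=> //.
  - by move=> k kM; have : psupport G k by rewrite sG /= ltnW.
  - move=> k Mk; apply: (@le_trans _ _ 0); last exact: mass_ge0.
    rewrite leNgt; apply/negP => gk.
    by have : psupport G k.+1 by []; rewrite sG /= ltnNge Mk.
  - by move=> k kM; have : psupport G k by rewrite sG.
have r0 k : 0 <= mass G k.+1 / mass G k by rewrite divr_ge0 ?mass_ge0.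
exists (1 + \sum_(k < M) mass G k.+1 / mass G k).
  by rewrite addr_ge0 ?sumr_ge0.
move=> k; have [kM|Mk] := ltnP k M.
  rewrite -ler_pdivrMr ?gM1 // (bigD1 (Ordinal kM)) //= addrCA lerDl.
  by rewrite addr_ge0 ?sumr_ge0.
rewrite mulrDl mul1r (le_trans (gM2 _ Mk)) // lerDl.
by rewrite mulr_ge0 ?sumr_ge0 ?mass_ge0.
Qed.

(** Under the variance condition the centring constant may be any real number, for
[k ^ 2 <= 2 (k - m) ^ 2 + 2 m ^ 2]. *)
Lemma second_moment_integrable (R : realType) (G : probability nat R) :
  assumption_G G -> G.-integrable setT (fun k : nat => ((k%:R : R) ^+ 2)%:E).
Proof.
case=> [[M [_ sG]]|[_ VG _]]; apply/integrableP; split=> //.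
  rewrite (eq_integral (fun k : nat => ((k%:R : R) ^+ 2)%:E)); last first.
    by move=> k _; rewrite gee0_abs // lee_fin sqr_ge0.
  rewrite ge0_integral_mass; last by move=> k; exact: sqr_ge0.
  apply: (@le_lt_trans _ _ (\sum_(k <oo) (M%:R ^+ 2 * mass G k)%:E)%E).
    apply: lee_nneseries => [k _ _|k _].
      by rewrite lee_fin mulr_ge0 ?sqr_ge0 ?mass_ge0.
    rewrite lee_fin; have [kM|Mk] := leqP k M.
      by rewrite ler_wpM2r ?mass_ge0 // ler_pXn2r ?nnegrE // ler_nat.
    suff -> : mass G k = 0 by rewrite !mulr0.
    apply/eqP; rewrite eq_le mass_ge0 andbT leNgt; apply/negP => gk.
    by have : psupport G k by []; rewrite sG /= leqNgt Mk.
  rewrite -ge0_integral_mass; last by move=> k; exact: sqr_ge0.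
  by rewrite integral_cst //= probability_setT mule1 ltry.
move: VG; rewrite /variance unlock; set m := fine _; rewrite unlock /= => VG.
apply: (@le_lt_trans _ _ (\int[G]_k (2%:E * ((k%:R - m) * (k%:R - m))%:E + (2 * m ^+ 2)%:E))%E).
  apply: ge0_le_integral => // k _; rewrite /= -EFinM -EFinD lee_fin.
  rewrite ger0_norm ?sqr_ge0 //.
  have := sqr_ge0 (k%:R - 2 * m); nra.
have sq k : 0 <= (k%:R - m) * (k%:R - m) by rewrite -expr2 sqr_ge0.
rewrite ge0_integralD //; last 2 first.
- by move=> k _; rewrite mule_ge0 // lee_fin.
- by move=> k _; rewrite lee_fin mulr_ge0 ?sqr_ge0.
rewrite integral_cst //= probability_setT mule1.
rewrite ge0_integralZl_EFin //; last by move=> k _; rewrite lee_fin.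
rewrite lte_add_pinfty ?ltry // lte_mul_pinfty //.
Qed.

Section innovation_moments.
Context {R : realType}.
Variable G : probability nat R.
Hypothesis G2 : G.-integrable setT (fun k : nat => ((k%:R : R) ^+ 2)%:E).

Lemma mean_integrable : G.-integrable setT (fun k : nat => (k%:R : R)%:E).
Proof.
apply: (le_integrable _ _ _ G2) => // k _; rewrite !abse_EFin lee_fin.
rewrite !ger0_norm ?sqr_ge0 // expr2 -natrM ler_nat.
by case: k => // k; rewrite leq_pmull.
Qed.

Lemma pmean_ge0 : 0 <= pmean G.
Proof. by apply: fine_ge0; apply: expectation_ge0. Qed.

Lemma integral_centered : (\int[G]_k ((k%:R : R) - pmean G)%:E = 0)%E.
Proof.
under eq_integral do rewrite EFinB.
rewrite integralB //; [|exact: mean_integrable|exact: finite_measure_integrable_cst].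
rewrite integral_cst //= probability_setT mule1 /pmean unlock fineK.
  by rewrite subee // integrable_fin_num // mean_integrable.
by rewrite integrable_fin_num // mean_integrable.
Qed.

Lemma centered_sq_integrable :
  G.-integrable setT (fun k : nat => (((k%:R : R) - pmean G) ^+ 2)%:E).
Proof.
apply: (@le_integrable _ _ _ G setT _ _
  (fun k => 2%:E * ((k%:R : R) ^+ 2)%:E + (2 * pmean G ^+ 2)%:E)%E) => //.
  move=> k _; rewrite -EFinM -EFinD !abse_EFin lee_fin !ger0_norm ?sqr_ge0 //.
    have := sqr_ge0 (k%:R + pmean G); nra.
  by rewrite addr_ge0 // mulr_ge0 ?sqr_ge0.
apply: integrableD => //; last exact: finite_measure_integrable_cst.
exact: integrableZl.
Qed.

Variable C : R.
Hypotheses (C0 : 0 <= C) (gC : forall k, mass G k.+1 <= C * mass G k).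
Local Notation r := (fun k => mass G k.+1 / mass G k).

Let r0 k : 0 <= r k. Proof. by rewrite divr_ge0 ?mass_ge0. Qed.

Let rC k : r k <= C.
Proof.
have [->|gk] := eqVneq (mass G k) 0; first by rewrite invr0 mulr0.
by rewrite ler_pdivrMr // lt0r gk mass_ge0.
Qed.

Let r_integrable : G.-integrable setT (fun k => (r k)%:E).
Proof.
apply: (@le_integrable _ _ _ G setT _ _ (cst C%:E)) => //.
  by move=> k _; rewrite /= lee_fin !ger0_norm.
exact: finite_measure_integrable_cst.
Qed.

(** The sum of [g(k + 1)] over all [k] is [1 - g(0)]. When [g k = 0] the quotient
is void, but then [g k.+1 = 0] as well. *)
Lemma integral_score : (\int[G]_k (r k)%:E = (1 - mass G 0%N)%:E)%E.
Proof.
rewrite ge0_integral_mass //.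
rewrite (eq_eseriesr (g := fun k => G [set k.+1])); last first.
  move=> k _; rewrite -massE //; congr EFin.
  have [g0|gk] := eqVneq (mass G k) 0; last by rewrite divfK.
  apply/eqP; rewrite g0 mulr0 eq_sym eq_le mass_ge0 andbT.
  by rewrite (le_trans (gC k)) // g0 mulr0.
transitivity (G (\bigcup_k [set k.+1])).
  rewrite measure_bigcup //.
    by apply: eq_eseriesl => k; rewrite in_setT.
  apply/trivIsetP => i j _ _ ij; apply/seteqP; split=> // k [/= ->] /eqP.
  by rewrite eqSS (negbTE ij).
rewrite EFinB massE // -probability_setC //; congr (G _).
apply/seteqP; split=> [k [j _ ->] //|[|k] //= _]; last by exists k.
Qed.

Lemma integral_centered_score :
  (\int[G]_k (r k - (1 - mass G 0%N))%:E = 0)%E.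
Proof.
under eq_integral do rewrite EFinB.
rewrite integralB //; last exact: finite_measure_integrable_cst.
by rewrite integral_score integral_cst //= probability_setT mule1 subee.
Qed.

Lemma centered_score_sq_integrable :
  G.-integrable setT (fun k => ((r k - (1 - mass G 0%N)) ^+ 2)%:E).
Proof.
apply: (@le_integrable _ _ _ G setT _ _ (cst ((C + 1) ^+ 2)%:E)) => //.
  move=> k _; rewrite /= lee_fin !ger0_norm ?sqr_ge0 //.
  have g0 := mass_ge0 _ _ _ G 0%N.
  have g1 : mass G 0%N <= 1 by rewrite -lee_fin massE // probability_le1.
  have := r0 k; have := rC k; simpl; nra.
exact: finite_measure_integrable_cst.
Qed.

End innovation_moments.

(** * Probabilities of the exceptional events *)

Lemma integral_indicator_prob (d : measure_display) (T : measurableType d) (R : realType)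
    (P : probability T R) (b : T -> bool) :
  measurable [set w | b w] -> (\int[P]_w ((b w)%:R : R)%:E = P [set w | b w])%E.
Proof.
move=> mb; rewrite -[X in P X]setIT -integral_indic //.
apply: eq_integral => w _; rewrite indicE; congr ((nat_of_bool _)%:R%:E).
by apply/idP/idP => [bw|]; [rewrite mem_set|rewrite inE].
Qed.

Lemma measurable_indicator (d : measure_display) (T : measurableType d)
    (R : realType) (b : T -> bool) :
  measurable [set w | b w] -> measurable_fun setT (fun w => (b w)%:R : R).
Proof.
move=> mb.
rewrite (_ : (fun w => _) = \1_[set w | b w]); first exact: measurable_indic.
apply/funext => w; rewrite indicE; congr ((nat_of_bool _)%:R).
by apply/idP/idP => [bw|]; [rewrite mem_set|rewrite inE].
Qed.

Lemma markov_count (d : measure_display) (T : measurableType d) (R : realType)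
    (P : probability T R) (I : finType) (b : I -> T -> bool) (p a : R) :
  (forall i, measurable [set w | b i w]) ->
  (forall i, P [set w | b i w] <= p%:E)%E -> 0 < a ->
  (P [set w | (a <= \sum_i ((b i w)%:R : R))%R] <= (#|I|%:R * p / a)%:E)%E.
Proof.
move=> mb bp a0.
have mb' i := measurable_indicator _ _ R _ (mb i).
apply: markov_bound => //.
- exact: measurable_sum.
- by move=> w; rewrite sumr_ge0.
under eq_integral do rewrite -sumEFin.
rewrite ge0_integral_sum //; last first.
  by move=> i; apply/measurable_EFinP; exact: mb'.
under eq_bigr do rewrite integral_indicator_prob //.
apply: (@le_trans _ _ (\sum_(i : I) p%:E)%E); first exact: lee_sum.
by rewrite sumEFin sumr_const mulr_natl.
Qed.

Section bad_events.
Context {R : realType} {d : measure_display} {T : measurableType d}.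
Variables (P : probability T R) (theta : R) (G : probability nat R).
Variables (Z : nat -> nat -> {mfun T >-> bool}) (eps : nat -> {mfun T >-> nat}).
Hypothesis theta01 : 0 <= theta <= 1.
Hypothesis noise : inar1_noise P theta G Z eps.

Lemma thinning_false_prob t j : P [set w | ~~ Z t j w] = (1 - theta)%:E.
Proof.
rewrite (_ : [set _ | _] = Z t j @^-1` [set false]).
  by rewrite (thinning_prob _ _ _ _ _ theta01 noise).
by apply/seteqP; split=> w /=; [move/negbTE|move=> ->].
Qed.

Lemma measurable_thinning_false t j : measurable [set w | ~~ Z t j w].
Proof.
rewrite (_ : [set _ | _] = Z t j @^-1` [set false]).
  by rewrite -[X in measurable X]setTI; exact: measurable_funPT.
by apply/seteqP; split=> w /=; [move/negbTE|move=> ->].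
Qed.

(** The number of deaths is dominated by the number of failing thinning variables
in a deterministic box, which avoids any dependence on the path. *)
Lemma many_deaths_prob n m (a : R) : 0 < a ->
  (P [set w | (a <= \sum_(p : 'I_n * 'I_m) ((~~ Z p.1 p.2 w)%:R : R))%R] <=
   (n%:R * m%:R * (1 - theta) / a)%:E)%E.
Proof.
move=> a0; rewrite -natrM (_ : (n * m)%N = #|{: 'I_n * 'I_m}|); last first.
  by rewrite card_prod !card_ord.
apply: (markov_count _ _ _ _ _ (fun (p : 'I_n * 'I_m) w => ~~ Z p.1 p.2 w)) => //.
  by move=> p; exact: measurable_thinning_false.
by move=> p; rewrite thinning_false_prob.
Qed.

Lemma double_death_prob n m :
  (P [set w | (1 <= \sum_(p : 'I_n * ('I_m * 'I_m))
     (([&& p.2.1 != p.2.2, ~~ Z p.1 p.2.1 w & ~~ Z p.1 p.2.2 w])%:R : R))%R] <=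
   (n%:R * m%:R ^+ 2 * (1 - theta) ^+ 2)%:E)%E.
Proof.
rewrite -[X in X%:E]divr1 -natrX -natrM.
rewrite (_ : (n * m ^ 2)%N = #|{: 'I_n * ('I_m * 'I_m)}|); last first.
  by rewrite !card_prod !card_ord.
apply: (markov_count _ _ _ _ _ (fun (p : 'I_n * ('I_m * 'I_m)) w =>
   [&& p.2.1 != p.2.2, ~~ Z p.1 p.2.1 w & ~~ Z p.1 p.2.2 w])) => //.
  move=> [t [i j]] /=; case: (i != j) => /=; last first.
    by rewrite (_ : [set _ | _] = set0) //; apply/seteqP; split.
  rewrite (_ : [set _ | _] = [set w | ~~ Z t i w] `&` [set w | ~~ Z t j w]).
    by apply: measurableI; exact: measurable_thinning_false.
  by apply/seteqP; split=> w /= /andP.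
move=> [t [i j]] /=; have [ij|ij] := eqVneq i j.
  rewrite (_ : [set _ | _] = set0) ?measure0 ?lee_fin ?sqr_ge0 //.
  by apply/seteqP; split.
have := noise_cylinder_prob P theta G Z eps theta01 noise
  [:: ((t : nat, i : nat), false); ((t : nat, j : nat), false)] [::].
rewrite /= !inE xpair_eqE eqxx /= !andbT => /(_ ij isT).
rewrite !big_cons !big_nil /= !mulr1 -expr2 => <-.
rewrite le_eqVlt; apply/orP; left; apply/eqP; congr (P _).
apply/seteqP; split=> w /=.
  move=> /andP[/negbTE zi /negbTE zj]; split=> //=.
  by rewrite /cylinder /= zi zj.
by move=> [/and3P[/= /eqP -> /eqP ->]].
Qed.

Let lawE t A : P (eps t @^-1` A) = G A.
Proof. exact: (innovation_prob _ _ _ _ _ noise). Qed.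

Let indE s t A B : s != t ->
  P (eps s @^-1` A `&` eps t @^-1` B) = (G A * G B)%E.
Proof.
move=> st.
have ind : mutual_independence P (fun t => eps t : T -> nat).
  by case: noise.
have := ind [:: s; t] (fun k => if k == s then A else B).
rewrite /= inE st => /(_ isT); rewrite bigcap_mkcond.
move=> /(_ (fun i => I)); rewrite !big_cons big_nil mule1 eqxx.
rewrite eq_sym in st; rewrite (negbTE st) !lawE => <-; congr (P _).
rewrite -bigcap_mkcond; apply/seteqP; split=> w.
  move=> [wA wB] k /=; rewrite !inE => /orP[] /eqP ->; rewrite ?eqxx //.
  by rewrite (negbTE st).
move=> h; split.
  by have := h s; rewrite /= !inE eqxx => /(_ isT).
by have := h t; rewrite /= !inE eqxx orbT (negbTE st) => /(_ isT).
Qed.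

Lemma weighted_deviation_prob (psi a : nat -> R) n (lam : R) :
  G.-integrable setT (fun k => (psi k ^+ 2)%:E) ->
  (\int[G]_k (psi k)%:E = 0)%E -> 0 < lam ->
  (P [set w | (lam <= (\sum_(s < n) a s * psi (eps s w)) ^+ 2)%R] <=
   ((\sum_(s < n) a s ^+ 2) * fine (\int[G]_k (psi k ^+ 2)%:E)%E / lam)%:E)%E.
Proof.
move=> psi2 psi0 lam0; apply: markov_bound => //.
- apply: measurable_funX; apply: measurable_sum => i.
  apply: measurable_funM => //.
  exact: (@measurableT_comp _ _ _ _ _ _ psi).
- by move=> w; rewrite sqr_ge0.
by rewrite (integral_weighted_sum_sq P G eps lawE indE).
Qed.

(** Summing the squares over [t] replaces a maximal inequality. *)
Lemma partial_sums_deviation_prob (psi : nat -> R) n (lam : R) :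
  G.-integrable setT (fun k => (psi k ^+ 2)%:E) ->
  (\int[G]_k (psi k)%:E = 0)%E -> 0 < lam ->
  (P [set w | (lam <= \sum_(t < n) (\sum_(s < t) psi (eps s w)) ^+ 2)%R] <=
   (n%:R ^+ 2 * fine (\int[G]_k (psi k ^+ 2)%:E)%E / lam)%:E)%E.
Proof.
move=> psi2 psi0 lam0.
have mS t : measurable_fun setT (fun w => (\sum_(s < t) psi (eps s w)) ^+ 2).
  apply: measurable_funX; apply: measurable_sum => i.
  exact: (@measurableT_comp _ _ _ _ _ _ psi).
apply: markov_bound => //.
- exact: measurable_sum.
- by move=> w; rewrite sumr_ge0 // => t _; rewrite sqr_ge0.
under eq_integral do rewrite -sumEFin.
rewrite ge0_integral_sum //; last 2 first.
- by move=> t; apply/measurable_EFinP.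
- by move=> t w _; rewrite lee_fin sqr_ge0.
set v := fine _.
have v0 : 0 <= v by apply: fine_ge0; apply: integral_ge0 => k _; rewrite lee_fin sqr_ge0.
rewrite (eq_bigr (fun t : 'I_n => (t%:R * v)%:E)); last first.
  move=> t _.
  rewrite (eq_integral
    (fun w => ((\sum_(s < t) 1 * psi (eps s w)) ^+ 2)%:E)); last first.
    by move=> w _; under [in RHS]eq_bigr do rewrite mul1r.
  rewrite (integral_weighted_sum_sq P G eps lawE indE psi psi2 psi0 (fun=> 1)).
  by rewrite sumr_const card_ord expr1n.
rewrite sumEFin lee_fin -mulr_suml ler_wpM2r // expr2.
apply: (@le_trans _ _ (\sum_(t < n) (n%:R : R))).
  by apply: ler_sum => t _; rewrite ler_nat ltnW.
by rewrite sumr_const card_ord mulr_natl.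
Qed.

End bad_events.

(** * Paths whose likelihood ratio is close to the limit *)

(** Domination of masses extends to all events because the space is countable, as
witnessed by the injection [f]. *)
Lemma le_measure_mass (d : measure_display) (T : measurableType d) (R : realType)
    (mu nu : probability T R) (f : T -> nat) (A : set T) (c : R) :
  injective f -> (forall B : set T, measurable B) -> 0 <= c ->
  (forall x, A x -> mass mu x <= c * mass nu x) -> (mu A <= c%:E * nu A)%E.
Proof.
move=> fi mT c0 le.
pose F k := A `&` f @^-1` [set k].
have AE : A = \bigcup_k F k.
  by apply/seteqP; split=> [x Ax|x [k _ []]//]; exists (f x).
have tF : trivIset setT F.
  apply/trivIsetP => i j _ _ /eqP ij; apply/seteqP; split=> // x [[_ /= xi] [_ /= xj]].
  by apply: ij; rewrite -xi -xj.
rewrite AE !measure_bigcup //.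
rewrite -nneseriesZl; last by move=> k _; exact: measure_ge0.
apply: lee_nneseries => [k _ _|k _]; first exact: measure_ge0.
have [[x [Ax fx]]|n0] := pselect (F k !=set0).
  have -> : F k = [set x].
    apply/seteqP; split=> [y [Ay fy]|y ->]; last by split.
    by apply: fi; rewrite fx fy.
  have h1 : ((mass mu x)%:E <= c%:E * (mass nu x)%:E)%E by rewrite -EFinM lee_fin le.
  by rewrite !massE // in h1.
have -> : F k = set0 by apply/seteqP; split=> // x Fx; apply: n0; exists x.
by rewrite !measure0 mule0.
Qed.

Lemma null_mass (d : measure_display) (T : measurableType d) (R : realType)
    (mu : probability T R) (f : T -> nat) :
  injective f -> (forall B : set T, measurable B) ->
  mu [set x | mass mu x = 0] = 0%E.
Proof.
move=> fi mT; apply/eqP; rewrite eq_le measure_ge0 andbT.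
have := le_measure_mass _ _ _ mu mu f [set x | mass mu x = 0] 0 fi mT (lexx _).
by rewrite mul0e; apply => x /= ->; rewrite mul0r.
Qed.

(** Paths possible under [P0] whose likelihood ratio is within a factor
[exp (+- eta)] of its announced limit, with the number of descents in the role of
the Poisson variable. *)
Definition good_path {R : realType} (g : nat -> R) (mu h h0 eta : R) (n : nat)
    (P P0 : probability (n.+1.-tuple nat) R) : set (n.+1.-tuple nat) :=
  [set x | mass P0 x != 0 /\
    exists2 V, likelihood_ratio P P0 x = (h / h0) ^+ descents n (nth 0%N x) * V &
      near_exp V (- ((h - h0) * g 0%N * mu / 2)) eta].

Section good_paths.
Context {R : realType} {d : measure_display} {T : measurableType d}.
Variables (P : R -> probability T R) (G : probability nat R).
Variables (Z : nat -> nat -> {mfun T >-> bool}) (eps : nat -> {mfun T >-> nat}).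
Hypothesis model : forall theta : R, 0 <= theta <= 1 ->
  inar1_noise (P theta) theta G Z eps.
Variable C : R.
Hypotheses (C0 : 0 <= C) (gC : forall k, mass G k.+1 <= C * mass G k).

Local Notation X := (inar1 (fun s j => Z s j) (fun s => eps s)).
Local Notation g := (mass G).
Local Notation m := (pmean G).
Local Notation score := (fun k => g k.+1 / g k - (1 - g 0%N)).
Let deaths t n w := (\sum_(j < n) ~~ Z t j w)%N.

Lemma deaths_balance t w : (X t.+1 w + deaths t (X t w) w = X t w + eps t w)%N.
Proof.
rewrite /= addnAC /deaths -big_split /=; congr (_ + _)%N.
rewrite (eq_bigr (fun=> 1%N)) ?sum1_card ?card_ord // => j _.
by case: (Z t j w).
Qed.

Lemma le_deaths t k l w : (k <= l)%N -> (deaths t k w <= deaths t l w)%N.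
Proof.
move=> kl; rewrite /deaths -!(big_mkord xpredT (fun j => nat_of_bool (~~ Z t j w))).
by rewrite (big_cat_nat_idem _ (leq0n k) kl) // leq_addr.
Qed.

(** Translation of [likelihood_near] to the probability space: outside the listed
events, the path stays below [kappa n], no time sees two deaths, and the
innovations obey the laws of large numbers. *)
Lemma good_path_of_noise (h h0 eta : R) (kappa : nat) :
  0 <= h -> 0 <= h0 -> 0 < eta -> m + 1 <= kappa%:R ->
  exists2 e, 0 < e & \forall n \near \oo, forall w x,
    x = inar1_path Z eps n w ->
    mass (inar1_law Z eps P n (near_unit n h0)) x != 0 ->
    \sum_(t < n) (\sum_(s < t) ((eps s w)%:R - m)) ^+ 2 < e ^+ 2 * n%:R ^+ 3 ->
    (\sum_(s < n) 1 * ((eps s w)%:R - m)) ^+ 2 < n%:R ^+ 2 ->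
    (\sum_(t < n) t%:R * score (eps t w)) ^+ 2 < (e * n%:R ^+ 2) ^+ 2 ->
    \sum_(p : 'I_n * 'I_(kappa * n)) ((~~ Z p.1 p.2 w)%:R : R) < e * n%:R ->
    \sum_(p : 'I_n * ('I_(kappa * n) * 'I_(kappa * n)))
     (([&& p.2.1 != p.2.2, ~~ Z p.1 p.2.1 w & ~~ Z p.1 p.2.2 w])%:R : R) < 1 ->
    good_path g m h h0 eta n (inar1_law Z eps P n (near_unit n h))
      (inar1_law Z eps P n (near_unit n h0)) x.
Proof.
move=> hh hh0 eta0 mk.
have m0 : 0 <= m := pmean_ge0 G.
have [A A0 HA] := likelihood_near R g C m h h0 kappa (mass_ge0 _ _ _ G) gC C0 m0 hh hh0.
(* With [1 / n <= e] the error [A (e + 1 / n)] is at most [eta]. *)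
pose e := eta / (2 * (A + 1)).
have A1 : 0 < A + 1 by rewrite ltr_wpDl.
have e0 : 0 < e by rewrite divr_gt0 // mulr_gt0.
have eE : A * (e + e) <= eta.
  rewrite (_ : eta = (A + 1) * (e + e)); last by rewrite /e; field; rewrite gt_eqF.
  by rewrite ler_wpM2r ?lerDl // addr_ge0 ?ltW.
exists e => //; near=> n => w x xw px hM hS hr hB hD.
have n1 : (0 < n)%N by near: n; exact: nbhs_infty_gt.
have n0 : 0 < n%:R :> R by rewrite ltr0n.
have ne : n%:R^-1 <= e.
  rewrite invf_ple ?posrE //; near: n; exact: nbhs_infty_ger.
have near01 k : 0 <= k -> k <= n%:R -> 0 <= near_unit n k <= 1.
  move=> k0 kn; rewrite /near_unit gerBl divr_ge0 ?sqr_ge0 // andbT subr_ge0.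
  rewrite ler_pdivrMr; last by rewrite exprn_gt0 ?ltr0n.
  rewrite mul1r (le_trans kn) // expr2 ler_peMr ?(ltW n0) //.
  by rewrite ler1n.
have hn : h <= n%:R by near: n; exact: nbhs_infty_ger.
have h0n : h0 <= n%:R by near: n; exact: nbhs_infty_ger.
have massx k : 0 <= k -> k <= n%:R ->
    mass (inar1_law Z eps P n (near_unit n k)) x =
    path_weight g (k / n%:R ^+ 2) n (nth 0%N x).
  move=> k0 kn; rewrite (mass_inar1_law _ _ _ _ _ _ G) //; last 2 first.
  - exact: near01.
  - by apply: model; exact: near01.
  rewrite /near_unit opprB addrCA subrr addr0.
  by rewrite xw (nth_mktuple _ _ (ord0 : 'I_n.+1)) /= mul1r.
split=> //; rewrite /likelihood_ratio !massx //.
rewrite massx // in px.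
have xE t : (t <= n)%N -> nth 0%N x t = X t w.
  by move=> tn; rewrite xw (nth_mktuple _ _ (Ordinal (tn : (t < n.+1)%N))).
have xS t : (t < n)%N -> (nth 0%N x t.+1 + deaths t (X t w) w =
    nth 0%N x t + eps t w)%N.
  by move=> tn; rewrite !xE ?(ltnW tn) // deaths_balance.
have x0 : nth 0%N x 0 = 0%N by rewrite xE.
have sumE t : \sum_(s < t) ((eps s w)%:R - m) = (\sum_(s < t) eps s w)%N%:R - m * t%:R.
  by rewrite sumrB -natr_sum sumr_const card_ord mulr_natr.
have Sn : (\sum_(s < n) eps s w <= kappa * n)%N.
  have hS' := hS; rewrite -mulr_sumr mul1r sumE in hS'; rewrite -(ler_nat R) natrM.
  have hS2 : (\sum_(s < n) eps s w)%N%:R - m * n%:R <= n%:R.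
    by rewrite leNgt; apply/negP => hlt; move: hS'; nra.
  by apply: (@le_trans _ _ ((m + 1) * n%:R)); [lra|rewrite ler_wpM2r].
have xk t : (t < n)%N -> (nth 0%N x t <= kappa * n)%N.
  move=> tn; apply: leq_trans Sn.
  have lag := path_lag n _ _ _ t x0 xS (ltnW tn).
  apply: (@leq_trans (\sum_(s < t) eps s w)); first by rewrite -lag leq_addr.
  rewrite -!(big_mkord xpredT (fun s => eps s w)).
  by rewrite [X in (_ <= X)%N](big_cat_nat_idem _ (leq0n t) (ltnW tn)) // leq_addr.
have dk t : (t < n)%N -> (deaths t (X t w) w <= deaths t (kappa * n) w)%N.
  by move=> tn; apply: le_deaths; rewrite -xE ?xk // ltnW.
have N1 t : (t < n)%N -> (deaths t (X t w) w <= 1)%N.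
  move=> tn; apply: leq_trans (dk t tn) _; rewrite leqNgt; apply/negP.
  rewrite /deaths -(big_mkcond (fun j : 'I_ _ => ~~ Z t j w) (fun=> 1%N)) sum1_card.
  move=> /card_gt1P[i [j [zi zj ij]]].
  have {}zi : ~~ Z t i w by exact: zi.
  have {}zj : ~~ Z t j w by exact: zj.
  move: hD; apply/negP; rewrite -leNgt (bigD1 (Ordinal tn, (i, j))) //= ij zi zj /=.
  by rewrite lerDl sumr_ge0.
have hB' : (\sum_(t < n) deaths t (X t w) w)%N%:R <= e * n%:R.
  apply: le_trans (ltW hB).
  rewrite -natr_sum ler_nat.
  rewrite -(pair_bigA _ (fun (t : 'I_n) (j : 'I_(kappa * n)) => (~~ Z t j w : nat))) /=.
  by apply: leq_sum => t _; exact: dk.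
have hM' : \sum_(t < n) ((\sum_(s < t) eps s w)%N%:R - m * t%:R) ^+ 2
    <= e ^+ 2 * n%:R ^+ 3.
  by apply: le_trans (ltW hM); under [leRHS]eq_bigr do rewrite sumE.
have hr' : `|\sum_(t < n) t%:R * score (eps t w)| <= e * n%:R ^+ 2.
  have en : 0 <= e * n%:R ^+ 2 by rewrite mulr_ge0 ?ltW // exprn_gt0.
  by rewrite -(ler_pXn2r (n := 2)) ?nnegrE // real_normK ?num_real // ltW.
have [V VE nV] : exists2 V, path_weight g (h / n%:R ^+ 2) n (nth 0%N x) /
        path_weight g (h0 / n%:R ^+ 2) n (nth 0%N x) =
         (h / h0) ^+ descents n (nth 0%N x) * V &
      near_exp V (- ((h - h0) * g 0%N * m / 2)) (A * (e + n%:R^-1)).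
  apply: (near HA n _ e _ (fun t => eps t w) (fun t => deaths t (X t w) w)) => //.
exists V => //; apply: near_exp_le nV; rewrite subrr normr0 add0r.
by apply: le_trans eE; rewrite ler_wpM2l // lerD2l.
Unshelve. all: by end_near.
Qed.
End good_paths.

Section good_path_prob.
Context {R : realType} {d : measure_display} {T : measurableType d}.
Variables (P : R -> probability T R) (G : probability nat R).
Variables (Z : nat -> nat -> {mfun T >-> bool}) (eps : nat -> {mfun T >-> nat}).
Hypothesis model : forall theta : R, 0 <= theta <= 1 ->
  inar1_noise (P theta) theta G Z eps.
Hypothesis G2 : G.-integrable setT (fun k : nat => ((k%:R : R) ^+ 2)%:E).
Variable C : R.
Hypotheses (C0 : 0 <= C) (gC : forall k, mass G k.+1 <= C * mass G k).

Local Notation g := (mass G).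
Local Notation m := (pmean G).
Local Notation score := (fun k => g k.+1 / g k - (1 - g 0%N)).
Local Notation v1 := (fine (\int[G]_k ((k%:R - m) ^+ 2)%:E)%E).
Local Notation v2 := (fine (\int[G]_k (score k ^+ 2)%:E)%E).
Local Notation law n h := (inar1_law Z eps P n (near_unit n h)).

(** Each of the events excluded in [good_path_of_noise] has probability [O(1 / n)]
by a first or second moment bound. *)
Lemma good_path_prob (h h0 eta : R) : 0 <= h -> 0 <= h0 -> 0 < eta ->
  exists c, \forall n \near \oo,
    (law n h0 (~` good_path g m h h0 eta n (law n h) (law n h0)) <=
     (c / n%:R)%:E)%E.
Proof.
move=> hh hh0 eta0.
have [kappa mk] : exists k : nat, m + 1 <= k%:R.
  (* Paths are below [(mu + 1) n] up to an exceptional event; [kappa] rounds up. *)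
  by exists (Num.truncn (m + 1)).+1; rewrite ltW // truncnS_gt.
have [e e0 HG] := good_path_of_noise P G Z eps model C C0 gC h h0 eta kappa hh hh0 eta0 mk.
exists (v1 / e ^+ 2 + v1 + v2 / e ^+ 2 + kappa%:R * h0 / e + kappa%:R ^+ 2 * h0 ^+ 2).
near=> n.
have n1 : (0 < n)%N by near: n; exact: nbhs_infty_gt.
have n0 : 0 < n%:R :> R by rewrite ltr0n.
have hn : h0 <= n%:R by near: n; exact: nbhs_infty_ger.
pose q := h0 / n%:R ^+ 2; pose th := near_unit n h0.
have th01 : 0 <= th <= 1.
  rewrite /th /near_unit gerBl divr_ge0 ?sqr_ge0 // andbT subr_ge0.
  rewrite ler_pdivrMr; last by rewrite exprn_gt0 ?ltr0n.
  by rewrite mul1r (le_trans hn) // expr2 ler_peMr ?(ltW n0) // ler1n.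
have qE : 1 - th = q by rewrite /th /near_unit opprB addrCA subrr addr0.
have noise := model th th01.
(* Paths of mass zero, and the failures of the five conditions of
   [good_path_of_noise]. *)
pose E0 := inar1_path Z eps n @^-1` [set x | mass (law n h0) x = 0].
pose E1 := [set w | (e ^+ 2 * n%:R ^+ 3 <=
  \sum_(t < n) (\sum_(s < t) ((eps s w)%:R - m)) ^+ 2)%R].
pose E2 := [set w | (n%:R ^+ 2 <= (\sum_(s < n) 1 * ((eps s w)%:R - m)) ^+ 2)%R].
pose E3 := [set w | ((e * n%:R ^+ 2) ^+ 2 <=
  (\sum_(t < n) t%:R * score (eps t w)) ^+ 2)%R].
pose E4 := [set w | (e * n%:R <=
  \sum_(p : 'I_n * 'I_(kappa * n)) ((~~ Z p.1 p.2 w)%:R : R))%R].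
pose E5 := [set w | (1 <= \sum_(p : 'I_n * ('I_(kappa * n) * 'I_(kappa * n)))
     (([&& p.2.1 != p.2.2, ~~ Z p.1 p.2.1 w & ~~ Z p.1 p.2.2 w])%:R : R))%R].
have P0 : P th E0 = 0%E.
  have mT (B : set (n.+1.-tuple nat)) : measurable B by exact: measurable_nat_tuple.
  exact: (null_mass _ _ _ (law n h0) pickle (pcan_inj pickleK) mT).
have i1 := integral_centered G G2.
have i2 := centered_sq_integrable G G2.
have j1 := integral_centered_score G C C0 gC.
have j2 := centered_score_sq_integrable G C C0 gC.
have P1 : (P th E1 <= (v1 / e ^+ 2 / n%:R)%:E)%E.
  apply: le_trans (partial_sums_deviation_prob _ _ _ _ _ noise
    (fun k => k%:R - m) n _ i2 i1 _) _.
    by rewrite mulr_gt0 // exprn_gt0.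
  by rewrite lee_fin le_eqVlt; apply/orP; left; apply/eqP; field; rewrite !gt_eqF.
have P2 : (P th E2 <= (v1 / n%:R)%:E)%E.
  apply: le_trans (weighted_deviation_prob _ _ _ _ _ noise
    (fun k => k%:R - m) (fun=> 1) n _ i2 i1 _) _; first by rewrite exprn_gt0.
  rewrite expr1n sumr_const card_ord.
  by rewrite lee_fin le_eqVlt; apply/orP; left; apply/eqP; field; rewrite !gt_eqF.
have v20 : 0 <= v2.
  by apply: fine_ge0; apply: integral_ge0 => k _; rewrite lee_fin sqr_ge0.
have P3 : (P th E3 <= (v2 / e ^+ 2 / n%:R)%:E)%E.
  apply: le_trans (weighted_deviation_prob _ _ _ _ _ noise
    score (fun t => t%:R) n _ j2 j1 _) _.
    by rewrite exprn_gt0 // mulr_gt0 // exprn_gt0.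
  rewrite lee_fin.
  apply: (@le_trans _ _ (n%:R ^+ 3 * v2 / (e * n%:R ^+ 2) ^+ 2)).
    rewrite ler_wpM2r ?invr_ge0 ?sqr_ge0 // ler_wpM2r //.
    apply: (@le_trans _ _ (\sum_(t < n) (n%:R ^+ 2 : R))).
      by apply: ler_sum => t _; rewrite ler_pXn2r ?nnegrE // ler_nat ltnW.
    by rewrite sumr_const card_ord -[leLHS]mulr_natr -exprSr.
  by rewrite le_eqVlt; apply/orP; left; apply/eqP; field; rewrite !gt_eqF.
have P4 : (P th E4 <= (kappa%:R * h0 / e / n%:R)%:E)%E.
  apply: le_trans (many_deaths_prob _ _ _ _ _ th01 noise n (kappa * n) _ _) _.
    by rewrite mulr_gt0.
  rewrite qE natrM /q.
  by rewrite lee_fin le_eqVlt; apply/orP; left; apply/eqP; field; rewrite !gt_eqF.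
have P5 : (P th E5 <= (kappa%:R ^+ 2 * h0 ^+ 2 / n%:R)%:E)%E.
  apply: le_trans (double_death_prob _ _ _ _ _ th01 noise n (kappa * n)) _.
  rewrite qE natrM /q.
  by rewrite lee_fin le_eqVlt; apply/orP; left; apply/eqP; field; rewrite !gt_eqF.
have mE0 : measurable E0.
  rewrite -[X in measurable X]setTI; apply: measurable_funPT => //.
  exact: measurable_nat_tuple.
have meps (f : nat -> R) t : measurable_fun setT (fun w => f (eps t w)).
  exact: (@measurableT_comp _ _ _ _ _ _ f).
have mE1 : measurable E1.
  apply: measurable_superlevel; apply: measurable_sum => t.
  apply: measurable_funX; apply: measurable_sum => s.
  exact: (meps (fun k => k%:R - m)).
have mE2 : measurable E2.
  apply: measurable_superlevel; apply: measurable_funX; apply: measurable_sum => s.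
  exact: (meps (fun k => 1 * (k%:R - m))).
have mE3 : measurable E3.
  apply: measurable_superlevel; apply: measurable_funX; apply: measurable_sum => s.
  exact: (meps (fun k => s%:R * score k)).
have mE4 : measurable E4.
  apply: measurable_superlevel; apply: measurable_sum => p.
  by apply: measurable_indicator; exact: measurable_thinning_false.
have mE5 : measurable E5.
  apply: measurable_superlevel; apply: measurable_sum => p.
  apply: measurable_indicator; case: (_ != _) => /=; last first.
    by rewrite (_ : [set _ | _] = set0) //; apply/seteqP; split.
  rewrite (_ : [set _ | _] = [set w | ~~ Z p.1 p.2.1 w] `&` [set w | ~~ Z p.1 p.2.2 w]).
    by apply: measurableI; exact: measurable_thinning_false.
  by apply/seteqP; split=> w /= /andP.
have sub : inar1_path Z eps n @^-1` (~` good_path g m h h0 eta n (law n h) (law n h0))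
   `<=` E0 `|` (E1 `|` (E2 `|` (E3 `|` (E4 `|` E5)))).
  move=> w /= ng; apply: contrapT => /not_orP[n_0].
  move=> /not_orP[/negP n_1 /not_orP[/negP n_2 /not_orP[/negP n_3 /not_orP[/negP n_4 /negP n_5]]]].
  apply: ng; apply: (near HG n _ w) => //; rewrite ?ltNge //.
  exact/eqP.
have le1 : (P th (inar1_path Z eps n @^-1`
     (~` good_path g m h h0 eta n (law n h) (law n h0))) <=
   P th (E0 `|` (E1 `|` (E2 `|` (E3 `|` (E4 `|` E5))))))%E.
  apply: le_measure => //; rewrite inE.
    rewrite -[X in measurable X]setTI; apply: measurable_funPT => //.
    exact: measurable_nat_tuple.
  by do 5 (apply: measurableU => //).
apply: (le_trans le1).
have U (A B : set T) a b : measurable A -> measurable B ->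
    (P th A <= a%:E)%E -> (P th B <= b%:E)%E -> (P th (A `|` B) <= (a + b)%:E)%E.
  move=> mA mB hA hB; apply: le_trans (measureU2 _ mA mB) _.
  by rewrite EFinD leeD.
apply: le_trans (U _ _ 0 _ _ _ _ (U _ _ _ _ _ _ P1 (U _ _ _ _ _ _ P2 (U _ _ _ _ _ _ P3
   (U _ _ _ _ _ _ P4 P5))))) _ => //.
all: try by do ?(apply: measurableU => //).
  by rewrite P0.
by rewrite lee_fin add0r !mulrDl !addrA.
Unshelve. all: by end_near.
Qed.

End good_path_prob.

(** * Poisson convergence by change of measure *)

Section discrete_probability.
Context {d : measure_display} {T : measurableType d} {R : realType}.
Hypothesis mT : forall B : set T, measurable B.
Variable Q : probability T R.

Definition prob (A : set T) : R := fine (Q A).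

Lemma probE A : (prob A)%:E = Q A.
Proof. by rewrite /prob fineK // fin_num_measure. Qed.

Lemma prob_ge0 A : 0 <= prob A.
Proof. exact: fine_ge0. Qed.

Lemma prob_le1 A : prob A <= 1.
Proof. by rewrite -lee_fin probE probability_le1. Qed.

Lemma probT : prob setT = 1.
Proof. by rewrite /prob probability_setT. Qed.

Lemma le_prob A B : A `<=` B -> prob A <= prob B.
Proof. by move=> AB; rewrite -lee_fin !probE le_measure ?inE. Qed.

Lemma probU A B : A `&` B = set0 -> prob (A `|` B) = prob A + prob B.
Proof. by move=> AB; apply: EFin_inj; rewrite EFinD !probE measureU. Qed.

Lemma probU_le A B : prob (A `|` B) <= prob A + prob B.
Proof. by rewrite -lee_fin EFinD !probE measureU2. Qed.

Lemma prob_split A B : prob A <= prob (A `&` B) + prob (~` B).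
Proof.
apply: le_trans (probU_le _ _); apply: le_prob => x Ax.
by have [Bx|Bx] := pselect (B x); [left|right].
Qed.

Lemma prob_levels (D : T -> nat) k :
  \sum_(j < k) prob [set x | D x = j] + prob [set x | (k <= D x)%N] = 1.
Proof.
elim: k => [|k IH].
  rewrite big_ord0 add0r (_ : [set _ | _] = setT) ?probT //.
  by apply/seteqP; split.
rewrite big_ord_recr /= -addrA -probU.
  rewrite -[RHS]IH; congr (_ + prob _); apply/seteqP; split=> x /=.
    by case=> [->|/ltnW].
  by rewrite leq_eqVlt => /orP[/eqP ->|]; [left|right].
by apply/seteqP; split=> // x [/= ->]; rewrite ltnn.
Qed.

End discrete_probability.
Arguments prob {d T R} Q A.

(** Integrating the two-sided bound on the likelihood ratio over the levels of [D],
on the good event, where it holds: the total mass of [Q1] is one, so the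
truncated generating function of [D] under [Q0] is close to [1 / a]. The
exceptional event must be small under both laws, and the levels from [k] on
contribute at most [s ^ k]. *)
Lemma change_of_measure (d : measure_display) (T : measurableType d)
    (R : realType) (Q0 Q1 : probability T R) (f : T -> nat) (D : T -> nat)
    (good : set T) (a eta s c0 c1 : R) (k : nat) :
  injective f -> (forall B : set T, measurable B) ->
  0 < a -> 0 < s <= 1 ->
  (forall x, good x ->
     s ^+ D x * a * expR (- eta) * mass Q0 x <= mass Q1 x /\
     mass Q1 x <= s ^+ D x * a * expR eta * mass Q0 x) ->
  prob Q0 (~` good) <= c0 -> prob Q1 (~` good) <= c1 ->
  \sum_(j < k) prob Q0 [set x | D x = j] * s ^+ j <= expR eta / a + k%:R * c0 /\
  1 <= a * expR eta * (\sum_(j < k) prob Q0 [set x | D x = j] * s ^+ j + s ^+ k)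
       + (k%:R + 1) * c1.
Proof.
move=> fi mT a0 /andP[s0 s1] hgood h0 h1.
have s00 := ltW s0; have a00 := ltW a0.
have cmp (mu nu : probability T R) (A : set T) (c : R) : 0 <= c ->
    (forall x, A x -> mass mu x <= c * mass nu x) -> prob mu A <= c * prob nu A.
  by move=> c00 h; rewrite -lee_fin EFinM !probE //; exact: (@le_measure_mass _ _ _ _ _ f).
have sj0 j : 0 < s ^+ j by rewrite exprn_gt0.
have cc0 : 0 <= c0 by apply: le_trans h0; exact: prob_ge0.
have cc1 : 0 <= c1 by apply: le_trans h1; exact: prob_ge0.
split.
  have low j : prob Q0 [set x | D x = j] * s ^+ j <=
      expR eta / a * prob Q1 [set x | D x = j] + c0.
    apply: (@le_trans _ _ ((prob Q0 ([set x | D x = j] `&` good) + c0) * s ^+ j)).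
      rewrite ler_wpM2r ?(ltW (sj0 _)) //.
      by apply: le_trans (prob_split mT _ _ good) _; rewrite lerD2l.
    rewrite mulrDl lerD //; last by rewrite ler_piMr // exprn_ile1.
    rewrite -ler_pdivlMr //.
    apply: (@le_trans _ _ (expR eta / a / s ^+ j * prob Q1 ([set x | D x = j] `&` good))).
      apply: cmp; first by rewrite !divr_ge0 ?expR_ge0 ?(ltW (sj0 _)).
      move=> x [Dx gx]; have [h _] := hgood x gx; rewrite Dx expRN in h.
      have e0 := expR_gt0 eta; have sj := sj0 j.
      have pos : 0 < expR eta / a / s ^+ j by rewrite !divr_gt0.
      apply: le_trans (ler_wpM2l (ltW pos) h).
      rewrite le_eqVlt; apply/orP; left; apply/eqP; field.
      by rewrite !gt_eqF.
    rewrite [leRHS]mulrAC; apply: ler_wpM2l.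
      by rewrite !divr_ge0 ?expR_ge0 ?(ltW (sj0 _)).
    by apply: le_prob => // x [].
  apply: (@le_trans _ _ (\sum_(j < k) (expR eta / a * prob Q1 [set x | D x = j] + c0))).
    exact: ler_sum.
  rewrite big_split /= sumr_const card_ord mulr_natl lerD2r -mulr_sumr.
  rewrite ler_piMr ?divr_ge0 ?expR_ge0 //.
  by rewrite -(prob_levels mT Q1 D k) lerDl prob_ge0.
have up j : prob Q1 [set x | D x = j] <=
    a * expR eta * (prob Q0 [set x | D x = j] * s ^+ j) + c1.
  apply: le_trans (prob_split mT _ _ good) _; apply: lerD => //.
  apply: (@le_trans _ _ (s ^+ j * a * expR eta * prob Q0 ([set x | D x = j] `&` good))).
    apply: cmp; first by rewrite !mulr_ge0 ?expR_ge0 ?(ltW (sj0 _)).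
    by move=> x [Dx gx]; have [_] := hgood x gx; rewrite Dx.
  rewrite [leRHS](_ : _ = s ^+ j * a * expR eta * prob Q0 [set x | D x = j]); last by ring.
  by rewrite ler_wpM2l ?le_prob ?mulr_ge0 ?expR_ge0 ?(ltW (sj0 _)) // => x [].
have uptail : prob Q1 [set x | (k <= D x)%N] <= a * expR eta * s ^+ k + c1.
  apply: le_trans (prob_split mT _ _ good) _; apply: lerD => //.
  apply: (@le_trans _ _ (s ^+ k * a * expR eta * prob Q0 ([set x | (k <= D x)%N] `&` good))).
    apply: cmp; first by rewrite !mulr_ge0 ?expR_ge0 ?(ltW (sj0 _)).
    move=> x [Dx gx]; have [_ h] := hgood x gx; apply: le_trans h _.
    by rewrite -!mulrA ler_wpM2r ?mulr_ge0 ?expR_ge0 ?mass_ge0 // ler_wiXn2l.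
  rewrite [leRHS](_ : _ = s ^+ k * a * expR eta * 1); last by ring.
  by rewrite ler_wpM2l ?prob_le1 ?mulr_ge0 ?expR_ge0 ?(ltW (sj0 _)).
rewrite -[leLHS](prob_levels mT Q1 D k).
apply: le_trans (lerD (ler_sum _ (fun (j : 'I_k) _ => up j)) uptail) _.
rewrite big_split /= sumr_const card_ord -mulr_sumr -[c1 *+ k]mulr_natl.
by rewrite le_eqVlt; apply/orP; left; apply/eqP; ring.
Qed.

(** The [k]-th mass is read off at a small argument [s]: after subtracting the terms
of lower degree, known by induction, and dividing by [s ^ k], the remaining
error is of order [s]. *)
Lemma pgf_inversion (R : realType) (p : nat -> nat -> R) (pi : nat -> R) (F : R -> R) :
  (forall s k e, 0 < s < 1 -> 0 < e -> \forall n \near \oo,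
     \sum_(j < k) p n j * s ^+ j - e <= F s <= \sum_(j < k) p n j * s ^+ j + s ^+ k + e) ->
  (forall s k, 0 < s < 1 ->
     \sum_(j < k) pi j * s ^+ j <= F s <= \sum_(j < k) pi j * s ^+ j + s ^+ k) ->
  forall k, p n k @[n --> \oo] --> pi k.
Proof.
move=> hp hpi; elim/ltn_ind => k IH; apply/cvgrPdist_le => e e0.
(* Three errors of size [s ^ (k + 1)] are divided by [s ^ k]. *)
pose s := Num.min (1 / 2) (e / 3).
have s0 : 0 < s by rewrite lt_min divr_gt0 //= divr_gt0.
have s1 : s < 1 by rewrite gt_min; apply/orP; left; lra.
have se : 3 * s <= e.
  by have : s <= e / 3 by [rewrite ge_min lexx orbT]; lra.
have s01 : 0 < s < 1 by rewrite s0.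
have sk : 0 < s ^+ k by rewrite exprn_gt0.
have sk1 : 0 < s ^+ k.+1 by rewrite exprn_gt0.
have cv : (\sum_(j < k) p n j * s ^+ j) @[n --> \oo] --> \sum_(j < k) pi j * s ^+ j.
  apply: cvg_big => //; first exact: add_continuous.
  by move=> j _; apply: cvgMl; exact: IH.
near=> n.
have /andP[a1 a2] : \sum_(j < k.+1) p n j * s ^+ j - s ^+ k.+1 <= F s <=
    \sum_(j < k.+1) p n j * s ^+ j + s ^+ k.+1 + s ^+ k.+1.
  by near: n; apply: hp.
have /andP[b1 b2] := hpi s k.+1 s01.
have c1 : `|\sum_(j < k) pi j * s ^+ j - \sum_(j < k) p n j * s ^+ j| <= s ^+ k.+1.
  by near: n; move/cvgrPdist_le : cv => /(_ _ sk1).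
move: a1 a2 b1 b2 c1; rewrite !big_ord_recr /= exprS.
move: (\sum_(j < k) _) (\sum_(j < k) _) (s ^+ k) sk => u v y y0 a1 a2 b1 b2.
rewrite ler_norml => /andP[c1 c2]; apply: le_trans se.
rewrite -(ler_pM2r y0) -[X in _ * X <= _](gtr0_norm y0) -normrM mulrBl -mulrA.
move: a1 a2 b1 b2; move: (F s) (pi k * y) (p n k * y) (s * y) c1 c2 => f A B z.
by move=> c1 c2 a1 a2 b1 b2; rewrite ler_norml; apply/andP; split; lra.
Unshelve. all: by end_near.
Qed.

(** * The number of descents *)

Lemma mass_poisson (R : realType) (lam : R) (k : nat) : 0 <= lam ->
  mass (poisson_prob lam 0%N) k = lam ^+ k * k`!%:R^-1 * expR (- lam).
Proof.
move=> lam0; rewrite /mass -[X in fine X]/(poisson_prob lam 0%N [set k]).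
rewrite /poisson_prob; case: ltP => [lam1|lam1].
  by rewrite esum_set1 ?lee_fin ?poisson_pmf_ge0 //= /poisson_pmf lam1.
have -> : lam = 0 by apply/eqP; rewrite eq_le lam1.
rewrite diracE oppr0 expR0 mulr1 expr0n /=.
case: k => [|k]; first by rewrite mem_set //= fact0 invr1 mulr1.
by rewrite memNset //= mul0r.
Qed.

Lemma mass_poisson_ratio (R : realType) (lam s : R) (k : nat) :
  0 <= lam -> 0 <= s ->
  mass (poisson_prob (s * lam) 0%N) k =
  s ^+ k * expR (lam - s * lam) * mass (poisson_prob lam 0%N) k.
Proof.
move=> lam0 s0; rewrite !mass_poisson ?mulr_ge0 // exprMn expRD.
have e0 : expR lam * expR (- lam) = 1 by rewrite -expRD subrr expR0.
rewrite -[LHS]mulr1 -e0; ring.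
Qed.

(** Tilting a Poisson law by [s ^ z] gives a Poisson law, so this is an exact instance
of [change_of_measure]. *)
Lemma poisson_pgf_bounds (R : realType) (lam s : R) (k : nat) :
  0 <= lam -> 0 < s < 1 ->
  \sum_(j < k) mass (poisson_prob lam 0%N) j * s ^+ j <= expR (lam * (s - 1)) <=
  \sum_(j < k) mass (poisson_prob lam 0%N) j * s ^+ j + s ^+ k.
Proof.
move=> lam0 /andP[s0 s1].
have a0 := expR_gt0 (lam - s * lam).
have s01 : 0 < s <= 1 by rewrite s0 ltW.
have [|||||] := change_of_measure _ _ R (poisson_prob lam 0%N)
  (poisson_prob (s * lam) 0%N) id id setT _ 0 s 0 0 k _ _ a0 s01 => //.
- move=> x _; rewrite oppr0 expR0 mulr1 mass_poisson_ratio ?(ltW s0) //.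
- by rewrite setCT /prob measure0.
- by rewrite setCT /prob measure0.
rewrite expR0 !mulr0 !addr0 mulr1 div1r -expRN opprB.
rewrite (_ : s * lam - lam = lam * (s - 1)); last by ring.
have sE : \sum_(j < k) prob (poisson_prob lam 0%N) [set x : nat | x = j] * s ^+ j =
    \sum_(j < k) mass (poisson_prob lam 0%N) j * s ^+ j.
  by apply: eq_bigr.
rewrite sE => -> h /=.
rewrite (_ : lam - s * lam = - (lam * (s - 1))) in h; last by ring.
by rewrite expRN -ler_pdivrMl ?invr_gt0 ?expR_gt0 // invrK mulr1 in h.
Qed.

Lemma kernel_no_thinning (R : realType) (g : nat -> R) (x y : nat) :
  (y < x)%N -> inar1_kernel 0 g x y = 0.
Proof.
elim: x y => [//|x IH] y yx /=; rewrite mul0r add0r subr0 mul1r.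
by case: y yx => // y; rewrite ltnS => /IH.
Qed.

Lemma path_weight_no_thinning (R : realType) (g : nat -> R) (n : nat) (x : nat -> nat) :
  path_weight g 0 n x != 0 -> descents n x = 0%N.
Proof.
move=> /prodf_neq0 h; rewrite /descents big1 // => t _.
by case: ltnP => // /(kernel_no_thinning R g) /eqP; rewrite (negbTE (h t isT)).
Qed.

Section descents.
Context {R : realType} {d : measure_display} {T : measurableType d}.
Variables (P : R -> probability T R) (G : probability nat R).
Variables (Z : nat -> nat -> {mfun T >-> bool}) (eps : nat -> {mfun T >-> nat}).
Hypothesis model : forall theta : R, 0 <= theta <= 1 ->
  inar1_noise (P theta) theta G Z eps.
Hypothesis G2 : G.-integrable setT (fun k : nat => ((k%:R : R) ^+ 2)%:E).
Variable C : R.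
Hypotheses (C0 : 0 <= C) (gC : forall k, mass G k.+1 <= C * mass G k).

Local Notation g := (mass G).
Local Notation m := (pmean G).
Local Notation law n h := (inar1_law Z eps P n (near_unit n h)).
Local Notation D n := (fun x : n.+1.-tuple nat => descents n (nth 0%N x)).
Local Notation good h h0 eta n := (good_path g m h h0 eta n (law n h) (law n h0)).

Lemma prob_not_good (h h0 eta : R) : 0 <= h -> 0 <= h0 -> 0 < eta ->
  exists c, \forall n \near \oo, prob (law n h0) (~` good h h0 eta n) <= c / n%:R.
Proof.
move=> hh hh0 eta0.
have [c hc] := good_path_prob P G Z eps model G2 C C0 gC h h0 eta hh hh0 eta0.
exists c; near=> n.
have mT (B : set (n.+1.-tuple nat)) : measurable B by exact: measurable_nat_tuple.
by rewrite -lee_fin probE //; near: n.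
Unshelve. all: by end_near.
Qed.

(** The likelihood ratio of the exchanged pair is the inverse; hence the good paths
for the pair are also typical under the alternative. *)
Lemma good_path_swap (h h0 eta : R) n : 0 < h -> 0 < h0 ->
  good h0 h eta n `<=` good h h0 eta n.
Proof.
move=> hh hh0 x [px [V VE nV]]; have V0 := near_exp_gt0 _ _ _ _ nV.
have LR0 : 0 < likelihood_ratio (law n h0) (law n h) x.
  by rewrite VE mulr_gt0 // exprn_gt0 // divr_gt0.
have p0 : mass (law n h0) x != 0.
  by apply: contraTneq LR0 => e; rewrite /likelihood_ratio e mul0r ltxx.
split=> //; exists V^-1.
  rewrite /likelihood_ratio -[LHS]invf_div -/(likelihood_ratio _ _ _) VE invfM.
  by rewrite -exprVn invf_div.
have := near_expV _ _ _ _ nV; rewrite opprK.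
by rewrite (_ : (h0 - h) * _ * _ / _ = - ((h - h0) * g 0%N * m / 2)) //; ring.
Qed.

Lemma good_path_mass (h h0 eta : R) n x : 0 <= h -> 0 <= h0 ->
  good h h0 eta n x ->
  (h / h0) ^+ D n x * expR (- ((h - h0) * g 0%N * m / 2)) * expR (- eta) *
    mass (law n h0) x <= mass (law n h) x /\
  mass (law n h) x <=
  (h / h0) ^+ D n x * expR (- ((h - h0) * g 0%N * m / 2)) * expR eta *
    mass (law n h0) x.
Proof.
move=> hh hh0 [px [V VE /andP[V1 V2]]].
have -> : mass (law n h) x = (h / h0) ^+ D n x * V * mass (law n h0) x.
  by rewrite -VE /likelihood_ratio divfK.
have q0 : 0 <= (h / h0) ^+ D n x by rewrite exprn_ge0 // divr_ge0.
by split; rewrite ler_wpM2r ?mass_ge0 // -mulrA ler_wpM2l // -expRD.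
Qed.

(** The likelihood ratio of [s h0] against [h0] is nearly [s ^ D exp (lam (1 - s))]
and integrates to one, so [s ^ D] has mean close to [exp (lam (s - 1))], the
Poisson generating function. *)
Lemma descents_cvg_pos (h0 : R) k : 0 < h0 ->
  prob (law n h0) [set x | D n x = k] @[n --> \oo] -->
  mass (poisson_limit G h0) k.
Proof.
move=> hh0; pose lam := h0 * g 0%N * m / 2.
have lam0 : 0 <= lam by rewrite !mulr_ge0 ?mass_ge0 ?pmean_ge0 // ltW.
apply: (pgf_inversion R (fun n k => prob (law n h0) [set x | D n x = k])
  (mass (poisson_limit G h0)) (fun s => expR (lam * (s - 1)))); last first.
  by move=> s j s01; exact: poisson_pgf_bounds.
move=> s {}k e /andP[s0 s1] e0.
(* [1 + b] is [exp eta]; the generating function truncated at [k] plus [s ^ k] is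
   at most [k + 1], so a relative error [b] costs at most [e / 2]. *)
pose b := e / (2 * (k%:R + 1)).
have k1 : 0 < k%:R + 1 :> R by rewrite ltr_wpDl.
have b0 : 0 < b by rewrite divr_gt0 // mulr_gt0.
have eb : expR (ln (1 + b)) = 1 + b by rewrite lnK // posrE addr_gt0.
have eta0 : 0 < ln (1 + b) by rewrite ln_gt0 // ltrDl.
have sh0 : 0 < s * h0 by rewrite mulr_gt0.
have [c0 H0] := prob_not_good (s * h0) h0 (ln (1 + b)) (ltW sh0) (ltW hh0) eta0.
have [c1 H1] := prob_not_good h0 (s * h0) (ln (1 + b)) (ltW hh0) (ltW sh0) eta0.
near=> n.
have n0 : 0 < n%:R :> R by near: n; exact: nbhs_infty_gtr.
have hc0 : k%:R * (c0 / n%:R) <= e / 2.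
  rewrite mulrA ler_pdivrMr // -ler_pdivrMl ?divr_gt0 //.
  by near: n; exact: nbhs_infty_ger.
have hc1 : (k%:R + 1) * (c1 / n%:R) <= e / 2.
  rewrite mulrA ler_pdivrMr // -ler_pdivrMl ?divr_gt0 //.
  by near: n; exact: nbhs_infty_ger.
pose a := expR (- ((s * h0 - h0) * g 0%N * m / 2)).
have aE : a = expR (- (lam * (s - 1))) by congr expR; rewrite /lam; ring.
have hs : s * h0 / h0 = s by rewrite mulfK // gt_eqF.
have mT (B : set (n.+1.-tuple nat)) : measurable B by exact: measurable_nat_tuple.
have [||||lo up] := change_of_measure _ _ R (law n h0) (law n (s * h0)) pickle (D n)
  (good (s * h0) h0 (ln (1 + b)) n) a (ln (1 + b)) s (c0 / n%:R) (c1 / n%:R) k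
  (pcan_inj pickleK) mT (expR_gt0 _).
- by rewrite s0 ltW.
- by move=> x /(good_path_mass _ _ _ _ _ (ltW sh0) (ltW hh0)); rewrite hs.
- by near: n.
- apply: (@le_trans _ _ (prob (law n (s * h0)) (~` good h0 (s * h0) (ln (1 + b)) n))).
    by apply: le_prob => //; apply: subsetC; exact: good_path_swap.
  by near: n.
have F1 : expR (lam * (s - 1)) <= 1.
  by rewrite expR_le1 mulr_ge0_le0 // subr_le0 ltW.
have F0 := expR_gt0 (lam * (s - 1)).
set F := expR (lam * (s - 1)) in F0 F1 *.
rewrite aE expRN -/F invrK eb in lo up.
have bk : (k%:R + 1) * b <= e / 2.
  by rewrite le_eqVlt; apply/orP; left; apply/eqP; rewrite /b; field; rewrite gt_eqF.
set S := \sum_(j < k) _ in lo up *.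
have Sk : S <= k%:R.
  apply: (@le_trans _ _ (\sum_(j < k) (1 : R))); last by rewrite sumr_const card_ord.
  apply: ler_sum => j _; rewrite mulr_ile1 ?prob_ge0 ?prob_le1 ?exprn_ge0 ?exprn_ile1 ?(ltW s0) ?(ltW s1) //.
have S0 : 0 <= S by apply: sumr_ge0 => j _; rewrite mulr_ge0 ?prob_ge0 // exprn_ge0 // ltW.
have sk0 : 0 <= s ^+ k by rewrite exprn_ge0 // ltW.
have sk1 : s ^+ k <= 1 by rewrite exprn_ile1 // ltW.
have k0 : 0 <= k%:R :> R by [].
apply/andP; split.
  have : b <= (k%:R + 1) * b by rewrite ler_peMl ?(ltW b0) // lerDr.
  have : b * F <= b by rewrite ler_piMr // ltW.
  rewrite mulrDl mul1r in lo; lra.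
have up' := ler_wpM2l (ltW F0) up.
rewrite mulr1 mulrDr !mulrA divff ?gt_eqF // mul1r in up'.
have h1 : (S + s ^+ k) * b <= (k%:R + 1) * b by rewrite ler_wpM2r ?(ltW b0) // lerD.
have h2 : F * ((k%:R + 1) * (c1 / n%:R)) <= e / 2.
  have [hc|hc] := leP 0 ((k%:R + 1) * (c1 / n%:R)).
    by apply: le_trans hc1; rewrite ler_piMl.
  by apply: (@le_trans _ _ 0); [rewrite pmulr_rle0 // ltW|rewrite divr_ge0 // ltW].
rewrite !mulrA in h2; lra.
Unshelve. all: by end_near.
Qed.

(** Without thinning a possible path never descends. *)
Lemma descents_cvg0 k :
  prob (law n 0) [set x | D n x = k] @[n --> \oo] --> mass (poisson_limit G 0) k.
Proof.
rewrite /poisson_limit !mul0r mass_poisson // oppr0 expR0 mulr1.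
suff H n : prob (law n 0) [set x | D n x = k] = (0 ^+ k / k`!%:R).
  by under eq_fun do rewrite H; exact: cvg_cst.
have t1 : near_unit n 0 = 1 :> R by rewrite /near_unit mul0r subr0.
have mT (B : set (n.+1.-tuple nat)) : measurable B by exact: measurable_nat_tuple.
have D0 : prob (law n 0) [set x | D n x <> 0%N] = 0.
  apply/eqP; rewrite eq_le prob_ge0 andbT.
  have := null_mass _ _ _ (law n 0) pickle (pcan_inj pickleK) mT => h.
  apply: (@le_trans _ _ (prob (law n 0) [set x | mass (law n 0) x = 0])).
    apply: le_prob => // x /= Dx; apply/eqP; apply: contra_notT Dx.
    rewrite (mass_inar1_law _ _ _ _ _ _ G); last 2 first.
    - by rewrite t1 ler01 lexx.
    - by apply: model; rewrite t1 ler01 lexx.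
    rewrite t1 subrr mulf_eq0 negb_or => /andP[_].
    exact: path_weight_no_thinning.
  by rewrite /prob h.
case: k => [|k]; last first.
  rewrite expr0n mul0r; apply/eqP; rewrite eq_le prob_ge0 andbT.
  apply: (@le_trans _ _ (prob (law n 0) [set x | D n x <> 0%N])); last by rewrite D0.
  by apply: le_prob => // x /= ->.
rewrite expr0 mul1r fact0 invr1 -(probT (law n 0)).
rewrite (_ : setT = [set x | D n x = 0%N] `|` [set x | D n x <> 0%N]).
  rewrite probU // ?D0 ?addr0 //.
  by apply/seteqP; split=> // x [].
by apply/seteqP; split=> // x _; exact: EM.
Qed.

Lemma descents_cvg (h0 : R) k : 0 <= h0 ->
  prob (law n h0) [set x | D n x = k] @[n --> \oo] --> mass (poisson_limit G h0) k.
Proof.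
rewrite le_eqVlt => /predU1P[<-|]; first exact: descents_cvg0.
exact: descents_cvg_pos.
Qed.

End descents.

(** * Convergence in distribution through an integer statistic *)

Section bounded_expectation.
Context {d : measure_display} {T : measurableType d} {R : realType}.
Hypothesis mT : forall B : set T, measurable B.
Variable Q : probability T R.

Let mfun (F : T -> R) : measurable_fun setT F.
Proof. by move=> _ B _; exact: mT. Qed.

Lemma bounded_integrable (F : T -> R) (M : R) : (forall x, `|F x| <= M) ->
  Q.-integrable setT (fun x => (F x)%:E).
Proof.
move=> FM; apply: (@le_integrable _ _ _ Q setT _ _ (cst M%:E)) => //.
- move=> x _; rewrite !abse_EFin lee_fin (le_trans (FM x)) //.
  exact: ler_norm.
- exact: finite_measure_integrable_cst.
Qed.

Lemma Rintegral_indicator_comb (I : finType) (c : I -> R) (b : I -> T -> bool) :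
  Q.-integrable setT (fun x => (\sum_i c i * (b i x)%:R)%:E) /\
  \int[Q]_x (\sum_i c i * (b i x)%:R) = \sum_i c i * prob Q [set x | b i x].
Proof.
have ib i : Q.-integrable setT (fun x => ((b i x)%:R : R)%:E).
  by apply: (bounded_integrable _ 1) => x; case: (b i x); rewrite ?normr0 ?normr1.
split.
  under eq_fun do rewrite -sumEFin.
  apply: integrable_sum => //= i _.
  under eq_fun do rewrite EFinM.
  exact: integrableZl.
rewrite /Rintegral.
under eq_integral do rewrite -sumEFin.
rewrite integral_sum //; last first.
  by move=> i; under eq_fun do rewrite EFinM; exact: integrableZl.
rewrite (eq_bigr (fun i => (c i * prob Q [set x | b i x])%:E)) ?sumEFin // => i _.
under eq_integral do rewrite EFinM.
by rewrite integralZl // integral_indicator_prob // EFinM probE.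
Qed.

(** On the level [D = j] the variable is [phi j] up to [e], except on a bad part;
levels from [K] on are bounded by [M]. *)
Lemma expectation_le_levels (F : T -> R) (D : T -> nat) (phi : nat -> R)
    (M e : R) (K : nat) :
  0 <= M -> 0 <= e -> (forall x, `|F x| <= M) -> (forall j, `|phi j| <= M) ->
  \int[Q]_x F x <= \sum_(j < K) phi j * prob Q [set x | D x = j] + e
    + 2 * M * \sum_(j < K) prob Q [set x | D x = j /\ e < `|F x - phi j|]
    + M * (1 - \sum_(j < K) prob Q [set x | D x = j]).
Proof.
move=> M0 e0 FM phiM.
pose c (i : 'I_K + ('I_K + unit)) := match i with
  | inl j => phi j + e | inr (inl j) => 2 * M | inr (inr _) => M end.
pose b (i : 'I_K + ('I_K + unit)) x := match i with
  | inl j => D x == j | inr (inl j) => (D x == j) && (e < `|F x - phi j|)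
  | inr (inr _) => (K <= D x)%N end.
have [ic Ec] := Rintegral_indicator_comb _ c b.
have iF := bounded_integrable _ _ FM.
apply: (@le_trans _ _ (\int[Q]_x (\sum_i c i * (b i x)%:R))).
  apply: le_Rintegral => // x _.
  have nn j : 0 <= 2 * M * ((D x == j) && (e < `|F x - phi j|))%:R by rewrite !mulr_ge0.
  rewrite big_sumType /= big_sumType /= (big_pred1 tt) /=; last by case.
  have /andP[F1 F2] : - M <= F x <= M by rewrite -ler_norml.
  have [DK|DK] := ltnP (D x) K; last first.
    rewrite !big1 ?add0r ?mulr1 // => j _.
      by rewrite gtn_eqF ?mulr0 // (leq_trans (ltn_ord j)).
    by rewrite gtn_eqF ?mulr0 // (leq_trans (ltn_ord j)).
  rewrite mulr0 addr0 (bigD1 (Ordinal DK)) //= eqxx mulr1.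
  rewrite [X in _ + X + _]big1 ?addr0; last first.
    by move=> j; rewrite -(inj_eq val_inj) /= => jD; rewrite eq_sym (negbTE jD) mulr0.
  rewrite (bigD1 (Ordinal DK)) //= eqxx /=.
  apply: (@le_trans _ _ (phi (D x) + e + 2 * M * (e < `|F x - phi (D x)|)%R%:R)).
    case: ltP => [_|].
      by have := phiM (D x); rewrite ler_norml => /andP[]; simpl; lra.
    by rewrite ler_norml => /andP[]; simpl; lra.
  by rewrite lerD2l lerDl sumr_ge0.
rewrite Ec big_sumType /= big_sumType /= (big_pred1 tt) /=; last by case.
have eqs j : [set x | D x == j] = [set x | D x = j].
  by apply/seteqP; split=> x /=; [move/eqP|move=> ->].
have eqb (j : nat) : [set x | (D x == j) && (e < `|F x - phi j|)] =
    [set x | D x = j /\ e < `|F x - phi j|].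
  by apply/seteqP; split=> x /=; [move=> /andP[/eqP]|move=> [-> ->]; rewrite eqxx].
under eq_bigr do rewrite eqs mulrDl.
under [X in _ + (X + _)]eq_bigr do rewrite eqb.
rewrite big_split /= -!mulr_sumr addrA.
have lev := prob_levels mT Q D K.
have tail : prob Q [set x | (K <= D x)%N] = 1 - \sum_(j < K) prob Q [set x | D x = j].
  by rewrite -lev addrC addKr.
rewrite tail lerD2r lerD2r lerD2l -[leRHS]mulr1 ler_wpM2l //.
by rewrite -lev lerDl prob_ge0.
Qed.

Lemma expectation_levels (F : T -> R) (D : T -> nat) (phi : nat -> R)
    (M e : R) (K : nat) :
  0 <= M -> 0 <= e -> (forall x, `|F x| <= M) -> (forall j, `|phi j| <= M) ->
  `|\int[Q]_x F x - \sum_(j < K) phi j * prob Q [set x | D x = j]| <= e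
    + 2 * M * \sum_(j < K) prob Q [set x | D x = j /\ e < `|F x - phi j|]
    + M * (1 - \sum_(j < K) prob Q [set x | D x = j]).
Proof.
move=> M0 e0 FM phiM.
have up := expectation_le_levels F D phi M e K M0 e0 FM phiM.
have lo : \int[Q]_x (- F x) <= \sum_(j < K) - phi j * prob Q [set x | D x = j] + e
    + 2 * M * \sum_(j < K) prob Q [set x | D x = j /\ e < `|- F x - - phi j|]
    + M * (1 - \sum_(j < K) prob Q [set x | D x = j]).
  apply: (expectation_le_levels (fun x => - F x) D (fun j => - phi j)) => //.
    by move=> x; rewrite normrN.
  by move=> j; rewrite normrN.
have eb j : [set x | D x = j /\ e < `|- F x - - phi j|] =
    [set x | D x = j /\ e < `|F x - phi j|].
  by apply/seteqP; split=> x /=; rewrite -opprD normrN.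
have sb : \sum_(j < K) prob Q [set x | D x = j /\ e < `|- F x - - phi j|] =
    \sum_(j < K) prob Q [set x | D x = j /\ e < `|F x - phi j|].
  by apply: eq_bigr => j _; rewrite eb.
have sN : \sum_(j < K) - phi j * prob Q [set x | D x = j] =
    - \sum_(j < K) phi j * prob Q [set x | D x = j].
  by rewrite -sumrN; apply: eq_bigr => j _; rewrite mulNr.
have eN : \int[Q]_x (- F x) = - \int[Q]_x F x.
  rewrite -mulN1r -RintegralZl //; last exact: (bounded_integrable _ M).
  by apply: eq_Rintegral => x _; rewrite mulN1r.
rewrite eN sb sN in lo; rewrite ler_norml; apply/andP; split.
  by rewrite lerNl opprB; move: lo; rewrite -!addrA lerNl; lra.
by rewrite lerBlDl !addrA.
Qed.

End bounded_expectation.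

Lemma prob_nat_tail (R : realType) (Q : probability nat R) (e : R) : 0 < e ->
  exists K, 1 - \sum_(j < K) mass Q j <= e.
Proof.
move=> e0; pose F K := [set x : nat | (x < K)%N].
have FT : \bigcup_K F K = setT.
  by apply/seteqP; split=> // x _; exists x.+1 => //; exact: ltnSn.
have : Q \o F @ \oo --> Q (\bigcup_K F K).
  apply: nondecreasing_cvg_mu => //.
  by move=> i j ij; apply/subsetPset => x /= xi; exact: leq_trans ij.
rewrite FT probability_setT => /fine_cvg /cvgrPdist_le /(_ e e0) [K _ HK].
exists K; have := HK K (leqnn K) => /= /(le_trans (ler_norm _)).
have mN (B : set nat) : measurable B by [].
have lev := prob_levels mN Q id K.
rewrite (_ : \sum_(j < K) mass Q j = 1 - prob Q [set x | (K <= x)%N]); last first.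
  by rewrite -lev addrK.
rewrite (_ : fine _ = 1 - prob Q [set x | (K <= x)%N]) //.
have <- : prob Q (F K) + prob Q [set x | (K <= x)%N] = 1.
  rewrite -probU // ?probT //.
    rewrite (_ : _ `|` _ = setT) ?probT //.
    by apply/seteqP; split=> // x _; case: (ltnP x K); [left|right].
  by apply/seteqP; split=> // x [/= h1]; rewrite leqNgt h1.
by rewrite addrK.
Qed.

(** Finitely many levels of the integer variable [D] carry almost all the mass, and
on each of them a bounded continuous function of [Y n] is nearly constant; its
mean is then nearly a finite sum of masses, and these converge. *)
Lemma cvg_in_distribution_levels (R : realType) (V : topologicalType)
    (d : nat -> measure_display) (T : forall n, measurableType (d n))
    (P : forall n, probability (T n) R) (Y : forall n, T n -> V)
    (D : forall n, T n -> nat) (Q : probability nat R) (Y' : nat -> V) :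
  (forall n (B : set (T n)), measurable B) ->
  (forall k, prob (P n) [set x | D n x = k] @[n --> \oo] --> mass Q k) ->
  (forall k U, nbhs (Y' k) U ->
    prob (P n) [set x | D n x = k /\ ~ U (Y n x)] @[n --> \oo] --> (0 : R)) ->
  cvg_in_distribution P Y Q Y'.
Proof.
move=> mT HD HY f cf [M fM].
have M0 : 0 <= M := le_trans (normr_ge0 _) (fM (Y' 0%N)).
have EE d' (T' : measurableType d') (S : probability T' R) (F : T' -> R) :
    (forall B : set T', measurable B) -> (forall x, `|F x| <= M) ->
    ('E_S[F])%E = (\int[S]_x F x)%:E.
  move=> mT' FM; rewrite unlock /Rintegral fineK // integrable_fin_num //.
  exact: (bounded_integrable mT' _ _ M).
rewrite EE //; last by move=> x; exact: fM.
suff H : \int[P n]_x (f \o Y n) x @[n --> \oo] --> \int[Q]_x (f \o Y') x.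
  have HE : (fun n => (\int[P n]_x (f \o Y n) x)%:E) @ \oo -->
      (\int[Q]_x (f \o Y') x)%:E.
    by apply: cvg_EFin => //; near=> n.
  rewrite (_ : (fun n => _) = (fun n => 'E_(P n)[f \o Y n]%E)) in HE; last first.
    by apply/funext => n; rewrite (EE _ _ _ _ (mT n)) // => x; exact: fM.
  exact: HE.
apply/cvgrPdist_le => e e0.
(* The six errors: one on the limit side, one on the finite sums, one level error,
   one bad event and two for the tail. *)
pose e' := e / 6; have e'0 : 0 < e' by rewrite divr_gt0.
have M1 : 0 < M + 1 by rewrite ltr_wpDl.
have [K HK] := prob_nat_tail R Q (e' / (M + 1)) (divr_gt0 e'0 M1).
pose phi j := f (Y' j).
have pM j : `|phi j| <= M by exact: fM.
pose bad n j := [set x | D n x = j /\ e' < `|f (Y n x) - phi j|].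
have cbad : (\sum_(j < K) prob (P n) (bad n j)) @[n --> \oo] --> (0 : R).
  suff : (\sum_(j < K) prob (P n) (bad n j)) @[n --> \oo] --> \sum_(j < K) (0 : R).
    by rewrite big1.
  apply: cvg_big => //; first exact: add_continuous.
  move=> j _.
  have nU : nbhs (Y' j : V) [set v | `|f (Y' j) - f v| <= e'].
    by have /cvgrPdist_le := cf (Y' j); exact.
  have bE n : [set x | D n x = j /\ ~ [set v | `|f (Y' j) - f v| <= e'] (Y n x)] = bad n j.
    apply/seteqP; split=> x /= [Dx h]; split=> //.
      by rewrite distrC ltNge; apply/negP.
    by apply/negP; rewrite -ltNge distrC.
  by have := HY j _ nU; under eq_fun do rewrite bE.
have cphi : (\sum_(j < K) phi j * prob (P n) [set x | D n x = j]) @[n --> \oo]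
    --> \sum_(j < K) phi j * mass Q j.
  apply: cvg_big => //; first exact: add_continuous.
  by move=> j _; apply: cvgMr; exact: HD.
have csum : (\sum_(j < K) prob (P n) [set x | D n x = j]) @[n --> \oo]
    --> \sum_(j < K) mass Q j.
  by apply: cvg_big => //; exact: add_continuous.
have eM : 0 < e' / (2 * (M + 1)) by rewrite divr_gt0 // mulr_gt0.
have QL : `|\int[Q]_x (f \o Y') x - \sum_(j < K) phi j * mass Q j| <= e'.
  have mN (B : set nat) : measurable B by [].
  have := expectation_levels mN Q (f \o Y') id phi M 0 K M0 (lexx _) (fun x => fM _) pM.
  rewrite [X in 2 * M * X]big1; last first.
    move=> j _; rewrite (_ : [set _ | _] = set0) ?/prob ?measure0 //.
    by apply/seteqP; split=> // x [/= -> ]; rewrite /phi subrr normr0 ltxx.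
  rewrite mulr0 add0r add0r => /le_trans; apply.
  apply: (@le_trans _ _ ((M + 1) * (e' / (M + 1)))); last by rewrite mulrC divfK // gt_eqF.
  apply: (@le_trans _ _ (M * (e' / (M + 1)))); first by rewrite ler_wpM2l.
  by rewrite ler_wpM2r ?lerDl // divr_ge0 // ltW.
near=> n.
have b1 : \sum_(j < K) prob (P n) (bad n j) <= e' / (2 * (M + 1)).
  near: n; move/cvgrPdist_le : cbad => /(_ _ eM); apply: filterS => n.
  by rewrite sub0r normrN => /(le_trans (ler_norm _)).
have b2 : `|\sum_(j < K) phi j * mass Q j -
   \sum_(j < K) phi j * prob (P n) [set x | D n x = j]| <= e'.
  by near: n; move/cvgrPdist_le : cphi; exact.
have b3 : `|\sum_(j < K) mass Q j -
   \sum_(j < K) prob (P n) [set x | D n x = j]| <= e' / (2 * (M + 1)).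
  by near: n; move/cvgrPdist_le : csum; exact.
have := expectation_levels (mT n) (P n) (f \o Y n) (D n) phi M e' K M0 (ltW e'0) (fun x => fM _) pM.
rewrite -/(bad n _).
move=> L.
have s1 : 2 * M * (\sum_(j < K) prob (P n) (bad n j)) <= e'.
  apply: (@le_trans _ _ (2 * M * (e' / (2 * (M + 1))))); first by rewrite ler_wpM2l // mulr_ge0.
  rewrite (_ : 2 * M * _ = M / (M + 1) * e'); last by field; rewrite gt_eqF.
  by rewrite ler_piMl ?(ltW e'0) // ler_pdivrMr // mul1r lerDl.
have s2 : M * (1 - \sum_(j < K) prob (P n) [set x | D n x = j]) <= 2 * e'.
  have h : 1 - \sum_(j < K) prob (P n) [set x | D n x = j] <= 2 * (e' / (M + 1)).
    have := le_trans (ler_norm _) b3.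
    have : e' / (2 * (M + 1)) <= e' / (M + 1).
      by rewrite ler_wpM2l ?(ltW e'0) // lef_pV2 ?posrE ?mulr_gt0 //; lra.
    lra.
  apply: (@le_trans _ _ (M * (2 * (e' / (M + 1))))); first by rewrite ler_wpM2l.
  rewrite (_ : M * _ = M / (M + 1) * (2 * e')); last by field; rewrite gt_eqF.
  by rewrite ler_piMl ?mulr_ge0 ?(ltW e'0) ?(ltW e0) // ler_pdivrMr // mul1r lerDl.
have ee : e = 6 * e' by rewrite /e'; field.
have L' := le_trans L (lerD (lerD (lexx e') s1) s2).
move: L' b2 QL; rewrite !ler_norml /=.
move=> /andP[l1 l2] /andP[l3 l4] /andP[l5 l6]; apply/andP; split; lra.
Unshelve. all: by end_near.
Qed.

(** * The limit experiment *)

Lemma prob_exists_le (d : measure_display) (T : measurableType d) (R : realType)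
    (Q : probability T R) (l : nat) (A : 'I_l -> set T) :
  (forall B : set T, measurable B) ->
  prob Q [set x | exists i, A i x] <= \sum_i prob Q (A i).
Proof.
move=> mT; elim: l A => [|l IH] A.
  rewrite big_ord0 (_ : [set _ | _] = set0) ?/prob ?measure0 //.
  by apply/seteqP; split=> // x [[]].
rewrite big_ord_recr /=.
apply: le_trans (lerD (IH (fun i => A (widen_ord (leqnSn l) i))) (lexx _)).
apply: le_trans (probU_le mT _ _ _); apply: le_prob => // x [i Aix].
have [il|il] := ltnP i l.
  left; exists (Ordinal il); rewrite (_ : widen_ord _ _ = i) //.
  exact: val_inj.
right; rewrite (_ : ord_max = i) //; apply: val_inj; apply/eqP.
by rewrite eqn_leq il -ltnS ltn_ord.
Qed.

Section poisson_likelihood.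
Context {R : realType} (G : probability nat R).

(** For [h0 = 0] only [z = 0] has mass, and [0 / 0 = 0] with [0 ^ 0 = 1] makes the
formula right there. *)
Lemma poisson_likelihood_ratio (h h0 : R) (z : nat) : 0 <= h -> 0 <= h0 ->
  mass (poisson_limit G h0) z != 0 ->
  likelihood_ratio (poisson_limit G h) (poisson_limit G h0) z =
  expR (- ((h - h0) * mass G 0%N * pmean G / 2)) * (h / h0) ^+ z.
Proof.
move=> hh hh0 mz; rewrite /likelihood_ratio.
have c0 : 0 <= mass G 0%N * pmean G / 2.
  by rewrite !mulr_ge0 ?mass_ge0 ?pmean_ge0.
have rate k : k * mass G 0%N * pmean G / 2 = k * (mass G 0%N * pmean G / 2) by ring.
have [h00|hn] := eqVneq h0 0.
  move: mz; rewrite h00 /poisson_limit !rate mul0r !mass_poisson ?(mulr_ge0 hh c0) //.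
  rewrite subr0 oppr0 expR0 invr0 mulr0 !mulr1.
  case: z => [|z]; last by rewrite !expr0n /= mul0r eqxx.
  by rewrite !expr0 fact0 invr1 !mulr1 mul1r divr1.
apply: (canLR (mulfK mz)); rewrite /poisson_limit !rate.
have -> : h * (mass G 0%N * pmean G / 2) =
    (h / h0) * (h0 * (mass G 0%N * pmean G / 2)) by rewrite !mulrA divfK.
rewrite mass_poisson_ratio ?(mulr_ge0 hh0 c0) ?divr_ge0 // [expR (- _) * _]mulrC.
congr (_ * _ * _); congr expR.
by field.
Qed.

Lemma ae_poisson (h0 : R) (A : nat -> Prop) :
  (forall z, mass (poisson_limit G h0) z != 0 -> A z) ->
  {ae poisson_limit G h0, forall z, A z}.
Proof.
move=> hA; exists [set z | mass (poisson_limit G h0) z = 0]; split=> //.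
  exact: (@null_mass _ _ _ _ id).
by move=> z /= nAz; apply/eqP; apply: contra_notT nAz; exact: hA.
Qed.

End poisson_likelihood.

Section limit_experiment.
Context {R : realType} {d : measure_display} {T : measurableType d}.
Variables (P : R -> probability T R) (G : probability nat R).
Variables (Z : nat -> nat -> {mfun T >-> bool}) (eps : nat -> {mfun T >-> nat}).
Hypothesis model : forall theta : R, 0 <= theta <= 1 ->
  inar1_noise (P theta) theta G Z eps.
Hypothesis hG : assumption_G G.

Local Notation g := (mass G).
Local Notation m := (pmean G).
Local Notation law n h := (inar1_law Z eps P n (near_unit n h)).
Local Notation D n := (fun x : n.+1.-tuple nat => descents n (nth 0%N x)).
Local Notation LR n h h0 := (likelihood_ratio (law n h) (law n h0)).
Local Notation LRQ h h0 :=
  (likelihood_ratio (poisson_limit G h) (poisson_limit G h0)).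

Let mtuple n (B : set (n.+1.-tuple nat)) : measurable B.
Proof. exact: measurable_nat_tuple. Qed.

Lemma cvg_prob_not_good (h h0 eta : R) : 0 <= h -> 0 <= h0 -> 0 < eta ->
  prob (law n h0) (~` good_path g m h h0 eta n (law n h) (law n h0))
    @[n --> \oo] --> (0 : R).
Proof.
move=> hh hh0 eta0.
have G2 := second_moment_integrable R G hG.
have [C C0 gC] := mass_ratio_bound R G hG.
have [c hc] := prob_not_good P G Z eps model G2 C C0 gC h h0 eta hh hh0 eta0.
apply/cvgrPdist_le => e e0; near=> n.
have n0 : 0 < n%:R :> R by near: n; exact: nbhs_infty_gtr.
rewrite sub0r normrN ger0_norm ?prob_ge0 //.
apply: (@le_trans _ _ (c / n%:R)); first by near: n.
by rewrite ler_pdivrMr // -ler_pdivrMl //; near: n; exact: nbhs_infty_ger.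
Unshelve. all: by end_near.
Qed.

Lemma likelihood_ratio_level (h h0 e : R) (k : nat) : 0 <= h -> 0 <= h0 -> 0 < e ->
  mass (poisson_limit G h0) k != 0 ->
  prob (law n h0) [set x | D n x = k /\ e <= `|LRQ h h0 k - LR n h h0 x|]
    @[n --> \oo] --> (0 : R).
Proof.
move=> hh hh0 e0 mk.
set y := LRQ h h0 k.
have yE := poisson_likelihood_ratio G h h0 k hh hh0 mk.
have y0 : 0 <= y by rewrite /y yE mulr_ge0 ?expR_ge0 // exprn_ge0 // divr_ge0.
pose b := e / (2 * (y + 1)).
have b0 : 0 < b by rewrite divr_gt0 // mulr_gt0 // ltr_wpDl.
have eb : expR (ln (1 + b)) = 1 + b by rewrite lnK // posrE addr_gt0.
have eta0 : 0 < ln (1 + b) by rewrite ln_gt0 // ltrDl.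
have yb : y * b < e.
  rewrite /b mulrA ltr_pdivrMr; last by rewrite mulr_gt0 // ltr_wpDl.
  by rewrite mulrC ltr_pM2l //; lra.
apply: (squeeze_cvgr _ (cvg_cst 0) (cvg_prob_not_good _ _ _ hh hh0 eta0)).
apply: nearW => n; rewrite prob_ge0 /=; apply: (le_prob (mtuple n)) => x [/= Dx ex] [_ [V VE /andP[]]].
rewrite !expRD (expRN (ln (1 + b))) eb => V1 V2.
move: ex; apply/negP; rewrite -ltNge.
have q0 : 0 <= (h / h0) ^+ k by rewrite exprn_ge0 // divr_ge0.
have b1 : 0 < 1 + b by rewrite addr_gt0.
have U1 := ler_wpM2l q0 V1; have U2 := ler_wpM2l q0 V2.
rewrite Dx in VE; rewrite -VE in U1 U2.
rewrite mulrA [_ * expR _]mulrC -yE -/y in U1.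
rewrite mulrA [_ * expR _]mulrC -yE -/y in U2.
have U3 : y - y * b <= y / (1 + b).
  by rewrite ler_pdivlMr //; have := sqr_ge0 b; nra.
rewrite ltr_norml; apply/andP; split; lra.
Qed.

(** A level without mass in the limit has vanishing probability, whatever the
likelihood ratios are on it. *)
Lemma likelihood_ratios_level (l : nat) (h : 'I_l -> R) (h0 e : R) (k : nat) :
  (forall i, 0 <= h i) -> 0 <= h0 -> 0 < e ->
  prob (law n h0) [set x | D n x = k /\
    exists i, e <= `|LRQ (h i) h0 k - LR n (h i) h0 x|] @[n --> \oo] --> (0 : R).
Proof.
move=> hh hh0 e0.
have [mk|mk] := eqVneq (mass (poisson_limit G h0) k) 0.
  have G2 := second_moment_integrable R G hG.
  have [C C0 gC] := mass_ratio_bound R G hG.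
  have := descents_cvg P G Z eps model G2 C C0 gC h0 k hh0; rewrite mk.
  apply: (squeeze_cvgr _ (cvg_cst 0)); apply: nearW => n.
  by rewrite prob_ge0 /=; apply: (le_prob (mtuple n)) => x [].
have cv : (\sum_i prob (law n h0) [set x | D n x = k /\
    e <= `|LRQ (h i) h0 k - LR n (h i) h0 x|]) @[n --> \oo] --> (0 : R).
  suff : (\sum_i prob (law n h0) [set x | D n x = k /\
    e <= `|LRQ (h i) h0 k - LR n (h i) h0 x|]) @[n --> \oo] --> \sum_(i < l) (0 : R).
    by rewrite big1.
  apply: cvg_big => //; first exact: add_continuous.
  by move=> i _; exact: likelihood_ratio_level.
apply: (squeeze_cvgr _ (cvg_cst 0) cv); apply: nearW => n; rewrite prob_ge0 /=.
apply: le_trans (prob_exists_le _ _ _ _ _ _ (mtuple n)).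
by apply: (le_prob (mtuple n)) => x [Dx [i ei]]; exists i.
Qed.

(** [Phi] assembles the likelihood ratios, into a row vector or, for a single
parameter, into a real number. The reference parameter is given through [theta] so that
the value [1] can stand for [near_unit n 0]. *)
Lemma likelihood_cvg_in_distribution (V : topologicalType) (h0 : R) (l : nat)
    (h : 'I_l -> R) (Phi : ('I_l -> R) -> V) (theta : nat -> R) :
  (forall i, 0 <= h i) -> 0 <= h0 -> (forall n, theta n = near_unit n h0) ->
  (forall u U, nbhs (Phi u) U -> exists2 e, 0 < e &
     forall v, (forall i, `|u i - v i| < e) -> U (Phi v)) ->
  @cvg_in_distribution R V _ _ (fun n => inar1_law Z eps P n (theta n))
    (fun n x => Phi (fun i => likelihood_ratio (law n (h i))
        (inar1_law Z eps P n (theta n)) x))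
    _ _ (poisson_limit G h0) (fun z => Phi (fun i => LRQ (h i) h0 z)).
Proof.
move=> hh hh0 thE cPhi.
have -> : theta = fun n => near_unit n h0 by apply/funext.
have G2 := second_moment_integrable R G hG.
have [C C0 gC] := mass_ratio_bound R G hG.
apply: (cvg_in_distribution_levels _ _ _ _ _ _ (fun n => D n)) => //.
  by move=> k; exact: (descents_cvg P G Z eps model G2 C C0 gC).
move=> k U /cPhi[e e0 HU].
have cv := likelihood_ratios_level l h h0 e k hh hh0 e0.
apply: (squeeze_cvgr _ (cvg_cst 0) cv); apply: nearW => n; rewrite prob_ge0 /=.
apply: (le_prob (mtuple n)) => x [Dx nU]; split=> //; apply: contrapT => ne.
apply: nU; apply: HU => i; rewrite ltNge; apply/negP => ei; apply: ne.
by exists i.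
Qed.

End limit_experiment.

Theorem theorem3p1 (R : realType) (d : measure_display) (T : measurableType d)
    (P : R -> probability T R)
    (Z : nat -> nat -> {mfun T >-> bool}) (eps : nat -> {mfun T >-> nat})
    (G : probability nat R)
    (hmodel : forall theta : R, 0 <= theta <= 1 ->
       inar1_noise (P theta) theta G Z eps)
    (hG : assumption_G G) :
  [/\ lecam_cvg (inar1_experiment Z eps P) (poisson_experiment G),
      (forall h h0 : R, 0 <= h -> 0 < h0 ->
         cvg_in_distribution (V := R)
           (fun n => inar1_law Z eps P n (near_unit n h0))
           (fun n => likelihood_ratio
              (inar1_law Z eps P n (near_unit n h))
              (inar1_law Z eps P n (near_unit n h0)))
           (poisson_limit G h0)
           (likelihood_ratio (poisson_limit G h) (poisson_limit G h0)) /\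
         {ae poisson_limit G h0, forall z : nat,
           likelihood_ratio (poisson_limit G h) (poisson_limit G h0) z =
           expR (- ((h - h0) * mass G 0%N * pmean G / 2)) * (h / h0) ^+ z}) &
      (forall h : R, 0 <= h ->
         cvg_in_distribution (V := R)
           (fun n => inar1_law Z eps P n 1)
           (fun n => likelihood_ratio
              (inar1_law Z eps P n (near_unit n h)) (inar1_law Z eps P n 1))
           (poisson_limit G 0)
           (likelihood_ratio (poisson_limit G h) (poisson_limit G 0)) /\
         {ae poisson_limit G 0, forall z : nat,
           likelihood_ratio (poisson_limit G h) (poisson_limit G 0) z =
           expR (- (h * mass G 0%N * pmean G / 2)) * (z == 0%N)%:R})].
Proof.
have scalar (u : 'I_1 -> R) (U : set R) : nbhs (u ord0) U ->
    exists2 e : R, 0 < e & forall v, (forall i, `|u i - v i| < e) -> U (v ord0).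
  by move=> /nbhs_ballP[e /= e0 HU]; exists e => // v uv; apply: HU; exact: uv.
split.
- move=> k I h0 _.
  have H := likelihood_cvg_in_distribution P G Z eps hmodel hG 'rV[R]_k h0%:num k
    (fun i => (tnth I i)%:num) (fun v => \row_i v i) (fun n => near_unit n h0%:num).
  apply: H => // u U /nbhs_ballP[e /= e0 HU]; exists e => // v uv; apply: HU.
  by split=> // i j; rewrite !mxE; exact: uv.
- move=> h h0 hh hh0; split.
    exact: (likelihood_cvg_in_distribution P G Z eps hmodel hG R h0 1 (fun=> h)
      (fun v => v ord0) (fun n => near_unit n h0) (fun=> hh) (ltW hh0) (fun=> erefl) scalar).
  by apply: ae_poisson => z; exact: poisson_likelihood_ratio (ltW hh0).
- move=> h hh; split.
    apply: (likelihood_cvg_in_distribution P G Z eps hmodel hG R 0 1 (fun=> h)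
      (fun v => v ord0) (fun n => 1) (fun=> hh) (lexx _) _ scalar).
    by move=> n; rewrite /near_unit mul0r subr0.
  apply: ae_poisson => z mz; rewrite poisson_likelihood_ratio // subr0 invr0 mulr0.
  by rewrite expr0n.
Qed.
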